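(* Let $(X,d,\mu)$, $p$, $\underline{Q}_\mu$ be as in the context. Let $\theta_2\in(0,\min\{p,\underline{Q}_\mu\})$, $\theta\in[\theta_2,p)$, let $S^1\in\mathcal{ADR}_0(X)$ and $S^2\in\mathcal{ADR}_{\theta_2}(X)$ be closed sets, $S:=S^1\cup S^2$, and $\mathfrak m_k:=2^{k\theta}\mu\lfloor_{S^1}+2^{k(\theta-\theta_2)}\mathcal H_{\theta_2}\lfloor_{S^2}$, $k\in\mathbb N_0$. Let $\sigma_2\in(0,1]$ be such that $S^2$ is $\sigma_2$-porous. Then there is a constant $\underline c\ge1$ depending on $\sigma_2$ such that for each $c\ge\underline c$ there is a constant $C>0$ with $$\mathcal{GL}^{(3)}_p(f)\le C\,\mathcal{BSN}_{p,\{\mathfrak m_k\},c}(f)$$ for every $f\in L_p(\mathfrak m_0)$.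
   Context: Standing setting: $(X,d)$ complete separable metric space, $\mu$ a Borel regular locally finite outer measure, $\operatorname{supp}\mu=X$, uniformly locally doubling (for every $R>0$, $\sup_{r\in(0,R]}\sup_x\mu(B_{2r}(x))/\mu(B_r(x))<\infty$). Balls are closed, $B_r(x)=\{y:d(x,y)\le r\}$, $cB_r(x)=B_{cr}(x)$, $B_k(x)=B_{2^{-k}}(x)$. A fixed $p\in(1,\infty)$; $X$ supports a weak local $(1,p)$-Poincaré inequality (for every $R>0$ there are $C,\lambda\ge1$ with $\inf_c\frac{1}{\mu(B_r(x))}\int_{B_r(x)}|f-c|d\mu\le Cr(\frac{1}{\mu(B_{\lambda r}(x))}\int_{B_{\lambda r}(x)}(\operatorname{lip}f)^pd\mu)^{1/p}$ for Lipschitz $f$, $x\in X$, $r\in(0,R]$). $\underline{Q}_\mu$ is the infimum of $Q>0$ such that for every $R>0$ there is $C$ with $(r_{B'}/r_B)^Q\le C\mu(B')/\mu(B)$ for balls $B'\subset B$, $0<r_{B'}\le r_B\le R$. Notation: $\mathrm{Av}_{G,\mathfrak m}(g)=\mathfrak m(G)^{-1}\int_Gg\,d\mathfrak m$ if $\mathfrak m(G)>0$, else $0$; $\mathcal E_{\mathfrak m}(g,G):=\inf_c\mathrm{Av}_{G,\mathfrak m}(|g-c|)$; $\mathfrak m\lfloor_S(E)=\mathfrak m(E\cap S)$. $\mathcal H_{\vartheta,\delta}(E):=\inf\{\sum\mu(B_{r_i}(x_i))r_i^{-\vartheta}:E\subset\bigcup B_{r_i}(x_i),0<r_i<\delta\}$,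 $\mathcal H_\vartheta=\lim_{\delta\to0}\mathcal H_{\vartheta,\delta}$. $\mathcal{ADR}_\vartheta(X)$: closed $S'$ with $\varkappa_1\mu(B_r(x))r^{-\vartheta}\le\mathcal H_\vartheta(B_r(x)\cap S')\le\varkappa_2\mu(B_r(x))r^{-\vartheta}$ for $x\in S'$, $r\in(0,1]$. Porosity: a ball $B$ is $(S',\sigma)$-porous if there is a ball $B'\subset B\setminus S'$ with $r(B')\ge\sigma r(B)$; $S'$ is $\sigma$-porous if $B_r(x)$ is $(S',\sigma)$-porous for all $x\in S'$, $r\in(0,1]$. Brudnyi–Shvartsman functional: a finite family of closed balls $\{B_{r_i}(x_i)\}$ is $(S,c)$-nice if pairwise disjoint, $\max_ir_i\le1$, $B_{cr_i}(x_i)\cap S\ne\emptyset$ for all $i$. $k(r)$ is the integer with $r\in(2^{-k(r)-1},2^{-k(r)}]$; $\widetilde{\mathcal E}_{\mathfrak m_k}(f,B_r(x)):=\mathcal E_{\mathfrak m_k}(f,B_{2r}(x))$ if $B_r(x)\cap S\ne\emptyset$, else $0$; $\mathcal{BSN}_{p,\{\mathfrak m_k\},c}(f):=\sup\big(\sum_i\frac{\mu(B_{r_i}(x_i))}{r_i^p}(\widetilde{\mathcal E}_{\mathfrak m_{k(r_i)}}(f,B_{cr_i}(x_i)))^p\big)^{1/p}$ over all $(S,c)$-nice families. Gluing functional (with $\theta_1:=0$): $\Sigma^{i,j}_k:=\{(y,z)\in S^i\times S^j:d(y,z)\le2^{-k}\}$, $\operatorname{w}_k(y,z):=(\mu(B_k(y))\mu(B_k(z)))^{-1/2}$,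 $A^{i,j}_k(f)(y,z):=\mathrm{Av}_{B_k(y)\cap S^i,\mathcal H_{\theta_i}}\mathrm{Av}_{B_k(z)\cap S^j,\mathcal H_{\theta_j}}|f(y')-f(z')|$, $\mathcal{GL}^{(3)}_p(f):=\big(\sum_{i\ne j}\sum_{k\ge1}2^{k(p-\theta_i-\theta_j)}\iint_{\Sigma^{i,j}_k}\operatorname{w}_k(y,z)(A^{i,j}_k(f)(y,z))^pd\mathcal H_{\theta_i}(y)d\mathcal H_{\theta_j}(z)\big)^{1/p}$ over $(i,j)\in\{(1,2),(2,1)\}$. *)

(* Defs.v *)
From HB Require Import structures.
From mathcomp Require Import all_boot all_order all_algebra.
From mathcomp Require Import all_classical all_reals all_analysis.
Set Implicit Arguments. Unset Strict Implicit. Unset Printing Implicit Defensive.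
Import Order.TTheory GRing.Theory Num.Theory.
Local Open Scope classical_set_scope.
Local Open Scope ring_scope.

Section MetricMeasure.
Context {d : measure_display} {T : measurableType d} {R : realType}.
Variable dist : T -> T -> R.

Definition is_metric : Prop :=
  (forall x y, 0 <= dist x y) /\ (forall x y, dist x y = 0 <-> x = y) /\
  (forall x y, dist x y = dist y x) /\
  (forall x y z, dist x z <= dist x y + dist y z).

Definition cball (x : T) (r : R) : set T := [set y | dist x y <= r].

Definition dopen (U : set T) : Prop :=
  forall x, U x -> exists e : R, 0 < e /\ [set y | dist x y < e] `<=` U.

Definition dclosed (A : set T) : Prop := dopen (~` A).

Definition dcomplete : Prop :=
  forall u : nat -> T,
    (forall e : R, 0 < e -> exists N, forall m n, (N <= m)%N -> (N <= n)%N ->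
        dist (u m) (u n) < e) ->
    exists l, forall e : R, 0 < e -> exists N, forall n, (N <= n)%N -> dist (u n) l < e.

Definition dseparable : Prop :=
  exists D : set T, countable D /\
    forall x (e : R), 0 < e -> exists y, D y /\ dist x y < e.

Definition borel_structure : Prop :=
  forall A : set T, measurable A <-> <<s dopen >> A.

Variable mu : {measure set T -> \bar R}.

Definition locally_finite : Prop :=
  forall x, exists r : R, 0 < r /\ (mu (cball x r) < +oo)%E.

Definition full_support : Prop :=
  forall x U, dopen U -> U x -> (0 < mu U)%E.

Definition unif_loc_doubling : Prop :=
  forall Rr : R, 0 < Rr -> exists C : R, forall x (r : R), 0 < r <= Rr ->
    (mu (cball x (2 * r)) <= C%:E * mu (cball x r))%E.

(* Av_{G,m}(g) = m(G)^{-1} * int_G g dm if m(G) > 0, else 0;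
   [mass] is m(G) and [intg] is int_G g dm *)
Definition avg (mass intg : \bar R) : \bar R :=
  if (0 < mass)%E then (((fine mass)^-1)%:E * intg)%E else 0%E.

Definition AvM (m : {measure set T -> \bar R}) (G : set T) (g : T -> \bar R) : \bar R :=
  avg (m G) (\int[m]_(x in G) g x)%E.

Definition lipschitz (f : T -> R) : Prop :=
  exists L : R, forall x y, `|f x - f y| <= L * dist x y.

(* pointwise Lipschitz constant lip f(x) = limsup_{y -> x} |f(y)-f(x)|/d(x,y)
   (:= 0 at isolated points) *)
Definition lip (f : T -> R) (x : T) : \bar R :=
  ereal_inf [set ereal_sup ([set 0%E] `|`
      [set (`|f y - f x| / dist x y)%:E | y in [set y | 0 < dist x y <= rho]])
    | rho in [set rho : R | 0 < rho]].

Definition weak_local_poincare (p : R) : Prop :=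
  forall Rr : R, 0 < Rr -> exists C lam : R, 1 <= C /\ 1 <= lam /\
    forall f : T -> R, lipschitz f -> forall x (r : R), 0 < r <= Rr ->
      (ereal_inf [set AvM mu (cball x r) (fun y => (`|f y - c|)%:E) | c in [set: R]]
       <= (C * r)%:E *
          poweR (AvM mu (cball x (lam * r)) (fun y => poweR (lip f y) p)) p^-1)%E.

Definition Qset : set R :=
  [set Q | 0 < Q /\ forall Rr : R, 0 < Rr -> exists C : R,
     forall x r x' r', 0 < r' -> r' <= r -> r <= Rr ->
       cball x' r' `<=` cball x r ->
       (((r' / r) `^ Q)%:E <= C%:E * (mu (cball x' r') * ((fine (mu (cball x r)))^-1)%:E))%E].

Definition Qlow : \bar R := ereal_inf [set Q%:E | Q in Qset].

Definition Hdelta (th delta : R) (E : set T) : \bar R :=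
  ereal_inf [set v | exists (I : set nat) (x : nat -> T) (r : nat -> R),
     E `<=` \bigcup_(i in I) cball (x i) (r i) /\
     (forall i, I i -> 0 < r i < delta) /\
     v = (\sum_(i <oo | i \in I) (mu (cball (x i) (r i)) * ((r i) `^ (- th))%:E))%E].

(* H_th = lim_{delta -> 0} H_{th,delta} (a nondecreasing limit, i.e. a sup) *)
Definition Hcal (th : R) (E : set T) : \bar R :=
  ereal_sup [set Hdelta th delta E | delta in [set delta : R | 0 < delta]].

Definition ADR (th : R) (S' : set T) : Prop :=
  dclosed S' /\ exists k1 k2 : R, 0 < k1 /\ 0 < k2 /\
    forall x (r : R), S' x -> 0 < r <= 1 ->
      (k1%:E * mu (cball x r) * (r `^ (- th))%:E <= Hcal th (cball x r `&` S'))%E /\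
      (Hcal th (cball x r `&` S') <= k2%:E * mu (cball x r) * (r `^ (- th))%:E)%E.

Definition porous (sigma : R) (S' : set T) : Prop :=
  forall x (r : R), S' x -> 0 < r <= 1 ->
    exists y (r' : R), sigma * r <= r' /\ cball y r' `<=` cball x r `\` S'.

Variables (H2 : {measure set T -> \bar R}) (S1 S2 : set T) (theta theta2 : R).

(* m_k = 2^{k theta} mu|_{S1} + 2^{k (theta - theta2)} H_{theta2}|_{S2}, where H2
   is (the Borel restriction of) H_{theta2} *)
Definition mk_mass (k : int) (G : set T) : \bar R :=
  ((2 `^ (k%:~R * theta))%:E * mu (G `&` S1) +
   (2 `^ (k%:~R * (theta - theta2)))%:E * H2 (G `&` S2))%E.

Definition mk_int (k : int) (G : set T) (g : T -> \bar R) : \bar R :=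
  ((2 `^ (k%:~R * theta))%:E * (\int[mu]_(x in G `&` S1) g x) +
   (2 `^ (k%:~R * (theta - theta2)))%:E * (\int[H2]_(x in G `&` S2) g x))%E.

Definition Avmk (k : int) (G : set T) (g : T -> \bar R) : \bar R :=
  avg (mk_mass k G) (mk_int k G g).

Definition Emk (k : int) (f : T -> R) (G : set T) : \bar R :=
  ereal_inf [set Avmk k G (fun y => (`|f y - c|)%:E) | c in [set: R]].

Definition Lp_m0 (p : R) (f : T -> R) : Prop :=
  measurable_fun setT f /\ (mk_int 0 setT (fun x => (`|f x| `^ p)%:E) < +oo)%E.

Definition SS : set T := S1 `|` S2.

(* k(r) : the integer with r in (2^{-k-1}, 2^{-k}] *)
Definition kr (r : R) : int := Num.floor (- (ln r / ln 2)).

Definition Etil (k : int) (f : T -> R) (x : T) (r : R) : \bar R :=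
  if `[< cball x r `&` SS !=set0 >] then Emk k f (cball x (2 * r)) else 0%E.

Definition nice (c : R) (n : nat) (x : nat -> T) (r : nat -> R) : Prop :=
  (forall i j, (i < n)%N -> (j < n)%N -> i <> j ->
      cball (x i) (r i) `&` cball (x j) (r j) = set0) /\
  (forall i, (i < n)%N -> 0 < r i <= 1) /\
  (forall i, (i < n)%N -> cball (x i) (c * r i) `&` SS !=set0).

Definition BSN (p c : R) (f : T -> R) : \bar R :=
  ereal_sup [set v | exists (n : nat) (x : nat -> T) (r : nat -> R),
     nice c n x r /\
     v = poweR (\sum_(i < n)
        (mu (cball (x i) (r i)) * ((r i `^ p)^-1)%:E *
         poweR (Etil (kr (r i)) f (x i) (c * r i)) p))%E p^-1].

End MetricMeasure.

Section Gluing.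
Context {d : measure_display} {T : measurableType d} {R : realType}.
Variables (dist : T -> T -> R) (mu : {measure set T -> \bar R}).

(* A^{i,j}_k(f)(y,z) with Hi, Hj the (Borel restrictions of) H_{theta_i}, H_{theta_j} *)
Definition Aij (Hi Hj : {measure set T -> \bar R}) (Si Sj : set T) (k : nat)
    (f : T -> R) (y z : T) : \bar R :=
  AvM Hi (cball dist y (2 ^- k) `&` Si)
    (fun y' => AvM Hj (cball dist z (2 ^- k) `&` Sj)
       (fun z' => (`|f y' - f z'|)%:E)).

Definition wk (k : nat) (y z : T) : \bar R :=
  ((fine (mu (cball dist y (2 ^- k)) * mu (cball dist z (2 ^- k)))) `^ (- 2^-1))%:E.

Definition GLterm (p thi thj : R) (Hi Hj : {measure set T -> \bar R}) (Si Sj : set T)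
    (k : nat) (f : T -> R) : \bar R :=
  ((2 `^ (k%:R * (p - thi - thj)))%:E *
   \int[Hj]_(z in Sj)
     \int[Hi]_(y in [set y | Si y /\ (dist y z <= 2 ^- k)%R])
        (wk k y z * poweR (Aij Hi Hj Si Sj k f y z) p))%E.

(* GL^{(3)}_p(f), with theta_1 = 0; H1 = H_0, H2 = H_{theta2} *)
Definition GL3 (p theta2 : R) (H1 H2 : {measure set T -> \bar R}) (S1 S2 : set T)
    (f : T -> R) : \bar R :=
  poweR (\sum_(k <oo) (GLterm p 0 theta2 H1 H2 S1 S2 k.+1 f +
                       GLterm p theta2 0 H2 H1 S2 S1 k.+1 f))%E p^-1.

End Gluing.

(* Main.v *)
(** Fix a scale [h = 2^-k] and a maximal [2h]-separated net [z_j] of [S2].  Porosity puts,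
    inside each ball [B(z_j, h)], a ball of radius [sigma h] missing [S2]; shrinking it to
    [B_j] of radius [sigma h / 2] makes every point of [B_j] lie at distance between
    [sigma h / 2] and [h] from [S2].  Hence the balls [B_j] are disjoint within one scale and
    across scales that are far apart, so that the scales split into finitely many residue
    classes, each giving nice families.  For [c >= 10 / sigma] the ball [2 c B_j] contains
    [B(y, h)] and [B(z, h)] for all pairs [(y, z)] near [z_j] that enter the gluing functional,
    so [A_k(f)(y, z)] is at most a constant times the oscillation of [f] on [2 c B_j]; doubling
    and Ahlfors-David regularity turn the integral over such pairs into [mu(B_j) / r_j^p].

    The functional [BSN] uses [mu] on [S1] whereas [GL3] uses [H_0], so [H_0 <= C mu] on
    bounded Borel sets is also needed; it is proved by covering closed sets and then by inner
    regularity. *)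

Require Import Defs.
From HB Require Import structures.
From mathcomp Require Import all_boot all_order all_algebra.
From mathcomp Require Import all_classical all_reals all_analysis.
From mathcomp Require Import measurable_realfun ring lra.
Set Implicit Arguments. Unset Strict Implicit. Unset Printing Implicit Defensive.
Import Order.TTheory GRing.Theory Num.Theory.
Local Open Scope classical_set_scope.
Local Open Scope ring_scope.

(** * Metric topology, separated nets and measurability of balls *)

Section MetricBasics.
Context {d : measure_display} {T : measurableType d} {R : realType}.
Variable dist : T -> T -> R.
Hypothesis dM : is_metric dist.

Lemma distxx x : dist x x = 0.
Proof. by case: dM => _ [/(_ x x) [_ ->]]. Qed.

Lemma distC x y : dist x y = dist y x.
Proof. by case: dM => _ [_ []]. Qed.

Lemma dist_tri y x z : dist x z <= dist x y + dist y z.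
Proof. by case: dM => _ [_ [_]]. Qed.

Lemma cballxx x (r : R) : 0 <= r -> cball dist x r x.
Proof. by rewrite /cball /= distxx. Qed.

Lemma subset_cball x y (r s : R) : dist x y + r <= s -> cball dist y r `<=` cball dist x s.
Proof.
move=> rs z /= yz; apply: le_trans (dist_tri y x z) _.
by apply: le_trans rs; rewrite lerD2l.
Qed.

Lemma dopen_oball x (r : R) : dopen dist [set y | dist x y < r].
Proof.
move=> y /= xy; exists (r - dist x y); split; first by rewrite subr_gt0.
by move=> z /= yz; apply: le_lt_trans (dist_tri y x z) _; rewrite -ltrBrDl.
Qed.

Lemma dclosed_cball x (r : R) : dclosed dist (cball dist x r).
Proof.
move=> y /=; rewrite /cball /= => /negP; rewrite -ltNge => ry.
exists (dist x y - r); split; first by rewrite subr_gt0.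
move=> z /= yz; apply/negP; rewrite -ltNge.
have := dist_tri z x y; rewrite (distC z y) -lerBlDr; apply: lt_le_trans.
by rewrite ltrBrDl -ltrBrDr.
Qed.

Lemma dopenT : dopen dist setT.
Proof. by move=> x _; exists 1. Qed.

Lemma dopen_bigcup (I : Type) (P : set I) (F : I -> set T) :
  (forall i, P i -> dopen dist (F i)) -> dopen dist (\bigcup_(i in P) F i).
Proof.
move=> oF x [i Pi Fx]; have [e [e0 eF]] := oF i Pi x Fx.
by exists e; split => // y /eF ?; exists i.
Qed.

Lemma dopenI (A B : set T) : dopen dist A -> dopen dist B -> dopen dist (A `&` B).
Proof.
move=> oA oB x [/oA[e [e0 eA]] /oB[e' [e'0 eB]]].
exists (Num.min e e'); split; first by rewrite lt_min e0.
by move=> y /=; rewrite lt_min => /andP[/eA ? /eB].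
Qed.

Lemma dclosedU (A B : set T) : dclosed dist A -> dclosed dist B -> dclosed dist (A `|` B).
Proof. by move=> cA cB; rewrite /dclosed setCU; exact: dopenI. Qed.

Lemma dclosed0 : dclosed dist set0.
Proof. by rewrite /dclosed setC0; exact: dopenT. Qed.

Lemma dclosed_bigcup_ltn (F : nat -> set T) (n : nat) :
  (forall i, dclosed dist (F i)) -> dclosed dist (\bigcup_(i in `I_n) F i).
Proof.
move=> cF; elim: n => [|n IH]; first by rewrite II0 bigcup_set0; exact: dclosed0.
by rewrite IIS bigcup_setU bigcup_set1; exact: dclosedU.
Qed.

(** Zorn's lemma gives a maximal [s]-separated subset, and maximality makes it a net. Sending each
    member to a point of the countable dense set within [s / 2] is injective, so the net can be
    indexed by a set of naturals. *)
Lemma separated_net (S : set T) (s : R) : dseparable dist -> 0 < s ->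
  exists (I : set nat) (x : nat -> T),
    [/\ forall i, I i -> S (x i),
        forall i j, I i -> I j -> i <> j -> s < dist (x i) (x j) &
        forall z, S z -> exists2 i, I i & dist (x i) z <= s].
Proof.
move=> [D [cD denseD]] s0.
pose P (A : set T) := A `<=` S /\ forall a b, A a -> A b -> a <> b -> s < dist a b.
have [F FP Ftot|A [[AS Asep] Amax]] := @Zorn_bigcup T P.
  split; first by move=> x [X /FP[XS _] /XS].
  move=> a b [X FX Xa] [Y FY Yb].
  have [XY|YX] := Ftot _ _ FX FY.
    by have [_] := FP _ FY; apply => //; exact: XY.
  by have [_] := FP _ FX; apply => //; exact: YX.
have /countable_injP[f finj] := cD.
have [e eP] : {e : T -> T & forall x, D (e x) /\ dist x (e x) < s / 2}.
  apply: (@choice _ _ (fun x y => D y /\ dist x y < s / 2)) => x.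
  by have [|y [Dy xy]] := denseD x (s / 2); [rewrite divr_gt0|exists y].
have einj a b : A a -> A b -> f (e a) = f (e b) -> a = b.
  move=> Aa Ab /finj; rewrite !inE => /(_ (eP a).1 (eP b).1) eab.
  apply: contrapT => /(Asep _ _ Aa Ab); apply/negP; rewrite -leNgt.
  apply: le_trans (dist_tri (e a) a b) _; rewrite [s]splitr.
  by rewrite lerD ?(ltW (eP a).2)// eab distC ltW// (eP b).2.
(* Members are indexed by their codes [f (e a)]; a number that codes no member gets an arbitrary
   point. *)
have [x xP] : {x : nat -> T & forall n, (exists2 a, A a & f (e a) = n) ->
    A (x n) /\ f (e (x n)) = n}.
  apply: (@choice _ _ (fun n y => (exists2 a, A a & f (e a) = n) -> A y /\ f (e y) = n)) => n.
  have [[a Aa fa]|na] := pselect (exists2 a, A a & f (e a) = n).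
    by exists a.
  by exists point.
exists [set n | exists2 a, A a & f (e a) = n], x; split.
- by move=> i /xP[/AS].
- move=> i j /xP[Ai fi] /xP[Aj fj] ij; apply: Asep => // xij.
  by apply: ij; rewrite -fi -fj xij.
- move=> z Sz; apply: contrapT => nz.
  have zfar a : A a -> s < dist a z.
    move=> Aa; rewrite ltNge; apply/negP => az; apply: nz.
    have Ia : exists2 a', A a' & f (e a') = f (e a) by exists a.
    exists (f (e a)) => //; have [Ax fx] := xP _ Ia.
    by rewrite (einj _ _ Ax Aa fx).
  have nAz : ~ A z by move=> /zfar; rewrite distxx ltNge ltW.
  apply: (Amax (A `|` [set z])).
    by split; [exact: subsetUl|move=> /(_ z) Az; apply: nAz; apply: Az; right].
  split; first by move=> y [/AS|->].
  move=> a b [Aa|->] [Ab|->] // ab.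
  - exact: Asep.
  - exact: zfar.
  - by rewrite distC; exact: zfar.
Qed.

Hypothesis borelT : borel_structure dist.

Lemma dopen_measurable (U : set T) : dopen dist U -> measurable U.
Proof. by move=> oU; apply/borelT; exact: sub_sigma_algebra. Qed.

Lemma dclosed_measurable (F : set T) : dclosed dist F -> measurable F.
Proof. by move=> /dopen_measurable/measurableC; rewrite setCK. Qed.

Lemma cball_measurable x (r : R) : measurable (cball dist x r).
Proof. exact/dclosed_measurable/dclosed_cball. Qed.

End MetricBasics.

(** * Inner regularity of finite Borel measures by closed sets *)

Section BorelRegularity.
Context {d : measure_display} {T : measurableType d} {R : realType}.
Variable dist : T -> T -> R.
Hypotheses (dM : is_metric dist) (borelT : borel_structure dist).
Variable nu : {measure set T -> \bar R}.
Hypothesis nu_fin : (nu setT < +oo)%E.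

Let nu_lty A : measurable A -> (nu A < +oo)%E.
Proof.
by move=> mA; apply: le_lt_trans nu_fin; apply: le_measure; rewrite ?inE//; exact: measurableT.
Qed.

(** Approximation from both sides is symmetric under complement, so the sets that have it can be
    shown to form a sigma-algebra. *)
Let approx (A : set T) := forall e : R, 0 < e -> exists F U,
  [/\ dclosed dist F, dopen dist U, F `<=` A, A `<=` U & (nu (U `\` F) <= e%:E)%E].

Let approxC A : approx A -> approx (~` A).
Proof.
move=> aA e /aA[F [U [cF oU FA AU UF]]]; exists (~` U), (~` F); split => //.
- by rewrite /dclosed setCK.
- exact: subsetC.
- exact: subsetC.
- by rewrite setDE setCK setIC -setDE.
Qed.

Let nonincreasing_small (F : nat -> set T) (e : R) : 0 < e ->
  (forall n, measurable (F n)) -> (forall n, F n.+1 `<=` F n) ->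
  \bigcap_n F n = set0 -> exists n, (nu (F n) <= e%:E)%E.
Proof.
move=> e0 mF dF F0.
have : (nu \o F) x @[x --> \oo] --> nu (\bigcap_n F n).
  apply: nonincreasing_cvg_mu => //.
  - exact: nu_lty.
  - by rewrite F0.
  - apply/nonincreasing_seqP => n; exact/subsetPset.
rewrite F0 measure0 => /fine_cvgP[_ /cvgrPdist_le/(_ e e0)[n _ /(_ n (leqnn n))]].
rewrite /= sub0r normrN => Fe; exists n.
rewrite -[nu _]fineK ?lee_fin; last first.
  by rewrite ge0_fin_numE ?nu_lty// measure_ge0.
exact: le_trans (ler_norm _) Fe.
Qed.

(** An open set is the increasing union of the closed sets of points whose open ball of radius
    [1 / (n + 1)] stays inside it; finiteness of [nu] makes the remainders small. *)
Let approx_open U : dopen dist U -> approx U.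
Proof.
move=> oU e e0.
pose F n := [set x | [set y | dist x y < n.+1%:R^-1] `<=` U].
have cF n : dclosed dist (F n).
  move=> x; rewrite /F /= => /nonsubset[y [/= xy nUy]].
  exists (n.+1%:R^-1 - dist x y); split; first by rewrite subr_gt0.
  move=> z /= xz zU; apply: nUy; apply: zU => /=.
  apply: le_lt_trans (dist_tri dM x z y) _.
  by rewrite (distC dM z x) -ltrBrDr.
have FU n : F n `<=` U.
  by move=> x; apply => /=; rewrite distxx// invr_gt0.
have [n Fn] : exists n, (nu (U `\` F n) <= e%:E)%E.
  apply: nonincreasing_small => //.
  - move=> n; apply: measurableD; first exact: (dopen_measurable borelT).
    exact: (dclosed_measurable borelT).
  - move=> n x [Ux nF]; split => // Fx; apply: nF => y /= xy.
    apply: Fx => /=; apply: lt_le_trans xy _.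
    by rewrite lef_pV2 ?posrE// ler_nat.
  - rewrite -subset0 => x UF; have [Ux _] := UF 0%N I.
    have [r [r0 rU]] := oU x Ux.
    have [n nr] : exists n : nat, n.+1%:R^-1 < r.
      exists (Num.trunc r^-1); rewrite invf_plt ?posrE//; exact: truncnS_gt.
    have [_] := UF n I; apply => y /= xy; apply: rU => /=; exact: lt_trans nr.
by exists (F n), U; split.
Qed.

(** Closed sets may be united only finitely often. Half of [e] pays for approximating the [A n],
    with geometric errors, and half for truncating the union of the closed sets. *)
Let approx_bigcup (A : nat -> set T) : (forall n, approx (A n)) -> approx (\bigcup_n A n).
Proof.
move=> aA e e0.
have e20 : 0 < e / 2 by rewrite divr_gt0.
have en0 n : 0 < e / 2 / (2 ^ n.+1)%:R :> R by rewrite divr_gt0// ltr0n expn_gt0.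
have [F FP] := choice (fun n => aA n _ (en0 n)).
have [U UP] := choice FP.
have cF n : dclosed dist (F n) by case: (UP n).
have oU n : dopen dist (U n) by case: (UP n).
have mF n : measurable (F n) by exact: (dclosed_measurable borelT).
have mU n : measurable (U n) by exact: (dopen_measurable borelT).
pose G n := \bigcup_(i in `I_n) F i.
have mG n : measurable (G n) by exact/(dclosed_measurable borelT)/dclosed_bigcup_ltn.
have mUF : measurable (\bigcup_n F n) by exact: bigcupT_measurable.
have [n Gn] : exists n, (nu ((\bigcup_n F n) `\` G n) <= (e / 2)%:E)%E.
  apply: nonincreasing_small => //.
  - by move=> n; apply: measurableD.
  - move=> n x [Fx nG]; split => // -[i ? Fix]; apply: nG; exists i => //=.
    exact: ltnW.
  - rewrite -subset0 => x FG; have [[n _ Fx] _] := FG 0%N I.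
    by have [_] := FG n.+1 I; apply; exists n => /=.
exists (G n), (\bigcup_n U n); split.
- exact: dclosed_bigcup_ltn.
- exact: dopen_bigcup.
- by move=> x [i _ Fx]; exists i => //; case: (UP i) => _ _ + _ _; exact.
- by move=> x [i _ Ax]; exists i => //; case: (UP i) => _ _ _ + _; exact.
have mUU : measurable (\bigcup_n (U n `\` F n)).
  by apply: bigcupT_measurable => i; exact: measurableD.
apply: (@le_trans _ _ (nu ((\bigcup_n (U n `\` F n)) `|` ((\bigcup_n F n) `\` G n)))).
  apply: le_measure; rewrite ?inE.
  - by apply: measurableD => //; exact: bigcupT_measurable.
  - by apply: measurableU => //; exact: measurableD.
  - move=> x [[i _ Ux] nG].
    have [Fx|nFx] := pselect (F i x); last by left; exists i.
    by right; split => //; exists i.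
apply: (le_trans (measureU2 _ _ _)) => //; first exact: measurableD.
rewrite [e in leRHS]splitr EFinD leeD//.
apply: (@le_trans _ _ (\sum_(n <oo) nu (U n `\` F n))%E).
  by apply: measure_sigma_subadditive => // i; exact: measurableD.
apply: le_trans (epsilon_trick0 xpredT (ltW e20)).
by apply: lee_nneseries => // i _; case: (UP i).
Qed.

(** The approximable sets contain the open sets and form a sigma-algebra, hence include all Borel
    sets. *)
Lemma dclosed_inner_regular (A : set T) (e : R) : measurable A -> 0 < e ->
  exists F, [/\ dclosed dist F, F `<=` A & (nu (A `\` F) <= e%:E)%E].
Proof.
move=> mA e0.
have : approx A.
  move/borelT: (mA); apply: (@smallest_sub _ (sigma_algebra setT)); last exact: approx_open.
  split.
  - apply: approx_open => x [].
  - by move=> B; rewrite setTD; exact: approxC.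
  - exact: approx_bigcup.
move=> /(_ e e0)[F [U [cF oU FA AU UF]]]; exists F; split => //.
have mF := dclosed_measurable borelT cF.
have mU := dopen_measurable borelT oU.
apply: le_trans UF; apply: le_measure; rewrite ?inE; [exact: measurableD..|].
by apply: setSD.
Qed.

End BorelRegularity.

(** * Volumes of balls, and the codimension-zero content of closed sets *)

Section Doubling.
Context {d : measure_display} {T : measurableType d} {R : realType}.
Variable dist : T -> T -> R.
Hypotheses (dM : is_metric dist) (sepT : dseparable dist) (borelT : borel_structure dist).
Variable mu : {measure set T -> \bar R}.
Hypotheses (mu_lf : locally_finite dist mu) (mu_full : full_support dist mu)
  (mu_dbl : unif_loc_doubling dist mu).

Let mball x (r : R) : measurable (cball dist x r).
Proof. exact: cball_measurable. Qed.

Lemma le_mu_cball x y (r s : R) : dist x y + r <= s ->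
  (mu (cball dist y r) <= mu (cball dist x s))%E.
Proof. by move=> /(subset_cball dM) ?; apply: le_measure; rewrite ?inE. Qed.

(** Local finiteness gives one ball of finite measure about [x], and doubling enlarges it step by
    step; the constants may vary with the step. *)
Lemma cball_lty x (r : R) : (mu (cball dist x r) < +oo)%E.
Proof.
have [r0 [r00 fin0]] := mu_lf x.
have fin n : (mu (cball dist x (2 ^+ n * r0)) < +oo)%E.
  elim: n => [|n IH]; first by rewrite mul1r.
  have rn : 0 < 2 ^+ n * r0 by rewrite mulr_gt0// exprn_gt0.
  have [C CP] := mu_dbl rn.
  rewrite exprS -mulrA; apply: le_lt_trans (CP x _ _) _; first by rewrite rn /=.
  move: IH; rewrite -ge0_fin_numE// => /fineK <-.
  by rewrite -EFinM ltry.
apply: le_lt_trans (fin (Num.Def.archi_bound (r / r0))); apply: le_mu_cball.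
by rewrite distxx// add0r -ler_pdivrMr// ltW// upper_nthrootP.
Qed.

Definition vol x (r : R) : R := fine (mu (cball dist x r)).

Lemma muE x r : mu (cball dist x r) = (vol x r)%:E.
Proof. by rewrite /vol fineK// ge0_fin_numE// cball_lty. Qed.

Lemma vol_gt0 x (r : R) : 0 < r -> 0 < vol x r.
Proof.
move=> r0; rewrite -lte_fin -muE.
have oB : dopen dist [set y | dist x y < r] by exact: dopen_oball.
apply: lt_le_trans (mu_full (x := x) oB _) _; first by rewrite /= distxx.
apply: le_measure; rewrite ?inE//; first exact: (dopen_measurable borelT).
by move=> y /ltW.
Qed.

Lemma le_vol x y (r s : R) : dist x y + r <= s -> vol y r <= vol x s.
Proof. by move=> /le_mu_cball; rewrite !muE lee_fin. Qed.

(** The ball of radius [s] about [x] lies in the ball of radius [2 L r] about [y]; with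
    [2 L < 2 ^ n], [n] doublings compare the latter with radius [r]. As [r <= 1], one doubling
    constant for radii up to [2 ^ n] suffices. *)
Lemma vol_comparable (L : R) : exists C : R, 0 < C /\
  forall x y (r s : R), 0 < r <= 1 -> s <= L * r -> dist x y <= L * r ->
    vol x s <= C * vol y r.
Proof.
pose n := Num.Def.archi_bound (2 * L).
have R0 : 0 < 2 ^+ n :> R by rewrite exprn_gt0.
have [C0 C0P] := mu_dbl R0.
pose C := Num.max C0 1.
have C_gt0 : 0 < C by rewrite lt_max ltr01 orbT.
have step y (r : R) : 0 < r <= 2 ^+ n -> vol y (2 * r) <= C * vol y r.
  move=> /[dup] /andP[r0 _] /(C0P y); rewrite !muE -EFinM lee_fin => /le_trans; apply.
  by rewrite ler_wpM2r ?le_max ?lexx// ltW// vol_gt0.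
exists (C ^+ n); split; first by rewrite exprn_gt0.
move=> x y r s /andP[r0 r1] sr xy.
have iter i : (i <= n)%N -> vol y (2 ^+ i * r) <= C ^+ i * vol y r.
  elim: i => [_|i IH i_n]; first by rewrite !mul1r.
  rewrite exprS -mulrA; apply: le_trans (step _ _ _) _.
    rewrite mulr_gt0 ?exprn_gt0//= -[leRHS]mulr1 ler_pM ?exprn_ge0 ?(ltW r0)//.
    by rewrite ler_eXn2l ?ltr1n// ltnW.
  by rewrite exprS -mulrA ler_wpM2l ?(ltW C_gt0)// IH// ltnW.
apply: le_trans (iter n (leqnn n)); apply: le_vol.
rewrite (distC dM y x); apply: le_trans (lerD xy sr) _.
rewrite -mulrDl ler_wpM2r ?(ltW r0)// -mulr2n -[L *+ 2]mulr_natl.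
by rewrite ltW// upper_nthrootP.
Qed.

(** The balls of radius [s] about an [s]-net of [F] cover [F]. Those of radius [s / 2] are disjoint
    and lie in the [s]-neighbourhood, so doubling bounds the content by the measure of this
    neighbourhood, which tends to [mu F] as [s] tends to 0. *)
Lemma Hcal0_dclosed : exists C : R, 0 < C /\ forall F x0 (R0 : R),
  dclosed dist F -> F `<=` cball dist x0 R0 -> (Hcal dist mu 0 F <= C%:E * mu F)%E.
Proof.
have [C [C0 CP]] := vol_comparable 2.
exists C; split => // F x0 R0 cF FB.
apply: ge_ereal_sup => _ [delta /= d0 <-].
pose N (s : R) := \bigcup_(x in F) [set y | dist x y < s].
have oN s : dopen dist (N s) by apply: dopen_bigcup => x _; exact: dopen_oball.
have mN s : measurable (N s) by exact: (dopen_measurable borelT).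
have cover s : 0 < s -> s < delta -> s <= 1 -> (Hdelta dist mu 0 delta F <= C%:E * mu (N s))%E.
  move=> s0 sd s1; have [I [x [xF xsep xcov]]] := separated_net dM F sepT s0.
  apply: (@le_trans _ _ (\sum_(i <oo | i \in I) (C%:E * mu (cball dist (x i) (s / 2))))%E).
    apply: (@le_trans _ _ (\sum_(i <oo | i \in I) (mu (cball dist (x i) s) * (s `^ (- 0))%:E))%E).
      apply: ereal_inf_lbound; exists I, x, (fun=> s); split => [z /xcov[i Ii xz]|].
        by exists i.
      by split => // i _; rewrite s0.
    apply: lee_nneseries => [i _ _|i _]; first by rewrite mule_ge0// lee_fin powR_ge0.
    rewrite oppr0 powRr0 mule1 !muE -EFinM lee_fin; apply: CP.
    - by rewrite divr_gt0//=; lra.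
    - by rewrite mulrCA mulfV ?mulr1.
    - by rewrite distxx// mulrCA mulfV ?mulr1// ltW.
  rewrite nneseriesZl//; apply: lee_wpmul2l; first by rewrite lee_fin ltW.
  rewrite -measure_bigcup//; last first.
    move=> i j Ii Ij [y [/= xi xj]]; apply: contrapT => ij.
    have := xsep _ _ Ii Ij ij; apply/negP; rewrite -leNgt.
    apply: le_trans (dist_tri dM y _ _) _; rewrite [leRHS]splitr.
    by rewrite lerD// distC.
  apply: le_measure; rewrite ?inE//; first exact: bigcup_measurable.
  move=> y [i Ii /= xy]; exists (x i); first exact: xF.
  by apply: le_lt_trans xy _; rewrite ltr_pdivrMr// mulr_natr mulr2n ltrDl.
pose s0 := Num.min (delta / 2) 1.
have s00 : 0 < s0 by rewrite lt_min ltr01 divr_gt0.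
have s0d : s0 < delta by rewrite gt_min ltr_pdivrMr// mulr_natr mulr2n ltrDl d0.
have s01 : s0 <= 1 by rewrite ge_min lexx orbT.
pose s n : R := s0 / n.+1%:R.
have s_gt0 n : 0 < s n by rewrite divr_gt0.
have s_le n : s n <= s0 by rewrite ler_pdivrMr// ler_peMr ?(ltW s00)// ler1n.
have mF : measurable F by exact: (dclosed_measurable borelT).
(* Closedness enters here: a point outside [F] has positive distance from [F]. Boundedness enters
   next, to give the first neighbourhood finite measure. *)
have capN : \bigcap_n N (s n) = F.
  apply/seteqP; split => [y yN|y Fy n _]; last by exists y => //=; rewrite distxx.
  apply: contrapT => /cF [e [e0 eF]].
  have [n ne] : exists n, s n < e.
    exists (Num.trunc (s0 / e)); rewrite ltr_pdivrMr// mulrC -ltr_pdivrMr//.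
    exact: truncnS_gt.
  have [x Fx /= xy] := yN n I.
  by apply: (eF x) => //=; rewrite distC//; exact: lt_trans ne.
have cvgN : (mu \o (N \o s)) x @[x --> \oo] --> mu F.
  rewrite -capN; apply: nonincreasing_cvg_mu.
  - apply: le_lt_trans (cball_lty x0 (R0 + s 0%N)).
    apply: le_measure; rewrite ?inE//= => y [x /FB /= x0x xy].
    by apply: le_trans (dist_tri dM x _ _) _; rewrite lerD// ltW.
  - by move=> i; exact: mN.
  - by apply: bigcapT_measurable => i; exact: mN.
  - apply/nonincreasing_seqP => n; apply/subsetPset => y [x Fx /= xy].
    exists x => //=; apply: lt_le_trans xy _.
    by rewrite ler_pM2l// lef_pV2 ?posrE// ler_nat.
have CcvgN := cvgeZl (isT : C%:E \is a fin_num) cvgN.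
move/cvge_to_ge: CcvgN; apply; apply: nearW => n /=; apply: cover => //.
  exact: le_lt_trans (s_le n) s0d.
exact: le_trans (s_le n) s01.
Qed.

(** * Domination of [H_0] by [mu] on bounded Borel sets *)

Section CodimensionZero.
Variable H0 : {measure set T -> \bar R}.
Hypothesis H0E : forall A, measurable A -> H0 A = Hcal dist mu 0 A.

(** The bound for closed sets makes [H0] finite on the ball; inner regularity of [H0] restricted to
    the ball then extends the bound to Borel subsets with the same constant. *)
Lemma H0_le_mu : exists C : R, 0 < C /\ forall A x0 (R0 : R),
  measurable A -> A `<=` cball dist x0 R0 -> (H0 A <= C%:E * mu A)%E.
Proof.
have [C [C0 CP]] := Hcal0_dclosed; exists C; split => // A x0 R0 mA AB.
pose nu := mrestr H0 (mball x0 R0).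
have nu_fin : (nu setT < +oo)%E.
  rewrite /nu /mrestr setTI H0E//.
  apply: le_lt_trans (CP _ x0 R0 _ _) _ => //; first exact: dclosed_cball.
  by rewrite muE -EFinM ltry.
apply/lee_addgt0Pr => e e0.
have [F [cF FA nuF]] := dclosed_inner_regular dM borelT nu_fin mA e0.
have mF := dclosed_measurable borelT cF.
rewrite -[in H0 A](setDUK FA).
apply: le_trans (measureU2 H0 mF (measurableD mA mF)) _.
have H0F : (H0 F <= C%:E * mu A)%E.
  rewrite H0E//; apply: le_trans (CP _ x0 R0 _ _) _ => //; first exact: subset_trans AB.
  apply: lee_wpmul2l; first by rewrite lee_fin ltW.
  by apply: le_measure; rewrite ?inE.
apply: leeD; first exact: H0F.
have AF : (A `\` F) `&` cball dist x0 R0 = A `\` F.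
  by apply: setIidl; apply: subset_trans AB; exact: subDsetl.
by apply: le_trans nuF; rewrite -{1}AF.
Qed.

(** Restricting both measures to [A] makes their comparison valid on every measurable set, as
    monotonicity of the integral in the measure requires. *)
Lemma integral_H0_le_mu : exists C : R, 0 < C /\ forall A x0 (R0 : R) (g : T -> \bar R),
  measurable A -> A `<=` cball dist x0 R0 ->
  (forall x, (0 <= g x)%E) -> measurable_fun setT g ->
  (\int[H0]_(x in A) g x <= C%:E * \int[mu]_(x in A) g x)%E.
Proof.
have [C [C0 CP]] := H0_le_mu; exists C; split => // A x0 R0 g mA AB g0 mg.
pose C' := NngNum (ltW C0).
rewrite (@eq_measure_integral _ _ _ A (mrestr H0 mA)); last first.
  by move=> B mB BA; rewrite /= /mrestr setIidl.
apply: (@le_trans _ _ (\int[mscale C' (mrestr mu mA)]_(x in A) g x)%E).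
  apply: ge0_le_measure_integral => // B mB.
  rewrite /mscale /mrestr /=; apply: (CP _ x0 R0); first exact: measurableI.
  by apply: subset_trans AB; exact: subIsetr.
rewrite ge0_integral_mscale//=; last exact: measurable_funTS.
rewrite (@eq_measure_integral _ _ _ A mu)// => B mB BA.
by rewrite /= /mrestr setIidl.
Qed.

End CodimensionZero.
End Doubling.

(** * Averages, and double averages of differences *)

Section IntegralFacts.
Context {d : measure_display} {T : measurableType d} {R : realType}.

Lemma le_poweR (x y : \bar R) (p : R) : 0 <= p -> (0 <= x)%E -> (x <= y)%E ->
  (poweR x p <= poweR y p)%E.
Proof.
move=> p0 x0 xy; apply: gt0_ler_poweR => //; rewrite in_itv /= leey andbT //.
exact: le_trans xy.
Qed.

(* Unlike [ge0_le_integral], no measurability: the iterated integrands of the gluing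
   functional need not be known to be measurable. *)
Lemma ge0_le_integral_nonmeas (m : {measure set T -> \bar R}) (D : set T) (f g : T -> \bar R) :
  (forall x, D x -> (0 <= f x)%E) -> (forall x, D x -> (f x <= g x)%E) ->
  (\int[m]_(x in D) f x <= \int[m]_(x in D) g x)%E.
Proof.
move=> f0 fg.
have g0 x : D x -> (0 <= g x)%E by move=> Dx; exact: le_trans (f0 _ Dx) (fg _ Dx).
rewrite !ge0_integralE//; apply: ge_ereal_sup => _ [h /= hf <-].
apply: ereal_sup_ubound; exists h => //= x; apply: le_trans (hf x) _.
by rewrite /patch; case: ifPn => // /set_mem /fg.
Qed.

Lemma avgE (m : R) (I : \bar R) : 0 < m -> avg m%:E I = (m^-1%:E * I)%E.
Proof. by move=> m0; rewrite /avg lte_fin m0. Qed.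

Lemma avg_ge0 (mass I : \bar R) : (0 <= mass)%E -> (0 <= I)%E -> (0 <= avg mass I)%E.
Proof.
move=> m0 I0; rewrite /avg; case: ifPn => // _.
by rewrite mule_ge0// lee_fin invr_ge0 fine_ge0.
Qed.

Lemma AvM_ge0 (m : {measure set T -> \bar R}) (G : set T) (g : T -> \bar R) :
  (forall x, (0 <= g x)%E) -> (0 <= AvM m G g)%E.
Proof. by move=> g0; apply: avg_ge0 => //; apply: integral_ge0. Qed.

(** The inequality [|f y - f z| <= |f y - c| + |f z - c|] is averaged in both variables; as the
    masses are positive and finite, a constant equals its own average. *)
Lemma AvM_AvM_le (Hi Hj : {measure set T -> \bar R}) (Gi Gj : set T) (mi mj : R)
    (f : T -> R) (c : R) :
  measurable Gi -> measurable Gj -> Hi Gi = mi%:E -> Hj Gj = mj%:E -> 0 < mi -> 0 < mj ->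
  measurable_fun setT f ->
  (AvM Hi Gi (fun y => AvM Hj Gj (fun z => (`|f y - f z|)%:E)) <=
   AvM Hi Gi (fun y => (`|f y - c|)%:E) + AvM Hj Gj (fun y => (`|f y - c|)%:E))%E.
Proof.
move=> mGi mGj HGi HGj mi0 mj0 mf.
have mfc G : measurable G -> measurable_fun G (fun y => (`|f y - c|)%:E).
  move=> mG; apply: measurable_funTS; apply/measurable_EFinP.
  by apply: measurableT_comp => //; exact: measurable_funB.
have average_cst (H : {measure set T -> \bar R}) G (m : R) (r : \bar R) :
    measurable G -> H G = m%:E -> 0 < m -> (m^-1%:E * \int[H]_(x in G) cst r x = r)%E.
  move=> mG HG m0; rewrite integral_cst// HG muleCA -EFinM mulVf ?mule1//.
  by rewrite gt_eqF.
set Aj := AvM Hj _ _.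
have Aj0 : (0 <= Aj)%E by apply: AvM_ge0 => x; rewrite lee_fin.
have inner y : (AvM Hj Gj (fun z => (`|f y - f z|)%:E) <= (`|f y - c|)%:E + Aj)%E.
  rewrite /Aj /AvM HGj !avgE//.
  rewrite -(average_cst Hj Gj mj (`|f y - c|)%:E mGj HGj mj0) -ge0_muleDr; last 2 first.
    by apply: integral_ge0 => x _; rewrite lee_fin.
    by apply: integral_ge0 => x _; rewrite lee_fin.
  apply: lee_wpmul2l; first by rewrite lee_fin invr_ge0 ltW.
  rewrite -ge0_integralD//; last 2 first.
    by move=> x _; rewrite lee_fin.
    exact: mfc.
  apply: ge0_le_integral_nonmeas => x _; first by rewrite lee_fin.
  by rewrite /cst -EFinD lee_fin (distrC (f x)); apply: ler_distD.
rewrite /AvM HGi !avgE//.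
rewrite -(average_cst Hi Gi mi Aj mGi HGi mi0) -ge0_muleDr; last 2 first.
  by apply: integral_ge0 => x _; rewrite lee_fin.
  by apply: integral_ge0.
apply: lee_wpmul2l; first by rewrite lee_fin invr_ge0 ltW.
rewrite -ge0_integralD//; last exact: mfc.
apply: ge0_le_integral_nonmeas => x _; last exact: inner.
by apply: AvM_ge0 => z; rewrite lee_fin.
Qed.

End IntegralFacts.

(** * Mass bounds for Ahlfors-David regular sets *)

Section AhlforsDavid.
Context {d : measure_display} {T : measurableType d} {R : realType}.
Variable dist : T -> T -> R.
Hypotheses (dM : is_metric dist) (sepT : dseparable dist) (borelT : borel_structure dist).
Variable mu : {measure set T -> \bar R}.
Hypotheses (mu_lf : locally_finite dist mu) (mu_full : full_support dist mu)
  (mu_dbl : unif_loc_doubling dist mu).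
Variables (th : R) (S : set T) (H : {measure set T -> \bar R}).
Hypotheses (HE : forall A, measurable A -> H A = Hcal dist mu th A)
  (adrS : ADR dist mu th S).

Local Notation vol := (vol dist mu).

Let mball x (r : R) : measurable (cball dist x r).
Proof. exact: cball_measurable. Qed.

Lemma ADR_measurable : measurable S.
Proof. by case: adrS => /(dclosed_measurable borelT). Qed.

Let mballS x (r : R) : measurable (cball dist x r `&` S).
Proof. by apply: measurableI => //; exact: ADR_measurable. Qed.

Lemma ADR_lower : exists k : R, 0 < k /\ forall x (h : R), S x -> 0 < h <= 1 ->
  ((k * vol x h * h `^ (- th))%:E <= H (cball dist x h `&` S))%E.
Proof.
case: adrS => _ [k1 [k2 [k10 [k20 kP]]]]; exists k1; split => // x h Sx h01.
by have [] := kP x h Sx h01; rewrite HE// muE.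
Qed.

(** The centre [x] need not lie in [S], so regularity is applied at the points of an [h]-net of [S]
    in the ball. Their balls of radius [h / 2] are disjoint and lie in the ball of radius
    [(L + 1) h], so doubling controls the sum. *)
Lemma ADR_upper (L : R) : exists C : R, 0 < C /\ forall x y (h : R), 0 < h <= 1 ->
  dist x y <= L * h ->
  (H (cball dist x (L * h) `&` S) <= (C * vol y h * h `^ (- th))%:E)%E.
Proof.
case: adrS => _ [k1 [k2 [k10 [k20 kP]]]].
have [C1 [C10 C1P]] := vol_comparable dM borelT mu_lf mu_full mu_dbl 2.
have [C2 [C20 C2P]] := vol_comparable dM borelT mu_lf mu_full mu_dbl (L + 1).
exists (k2 * C1 * C2); split; first by rewrite !mulr_gt0.
move=> x y h h01 xy; have /andP[h0 h1] := h01.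
have h20 : 0 < h / 2 by rewrite divr_gt0.
have [I [u [uS usep ucov]]] := separated_net dM (cball dist x (L * h) `&` S) sepT h0.
pose F i := if i \in I then cball dist (u i) h `&` S else set0.
have mF i : measurable (F i) by rewrite /F; case: ifP.
apply: (@le_trans _ _ (\sum_(i <oo) H (F i))%E).
  apply: measure_sigma_subadditive => // z [xz Sz].
  have [i Ii uz] := ucov z (conj xz Sz).
  by exists i => //; rewrite /F mem_set.
set K := k2 * C1 * h `^ (- th).
have hth0 : 0 <= h `^ (- th) by exact: powR_ge0.
apply: (@le_trans _ _ (\sum_(i <oo | i \in I) (K%:E * mu (cball dist (u i) (h / 2))))%E).
  rewrite [leRHS]eseries_mkcond; apply: lee_nneseries => // i _.
  rewrite /F; case: ifPn => [/set_mem Ii|_]; last by rewrite measure0.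
  rewrite HE//; have [_] := kP (u i) h (uS _ Ii).2 h01 => /le_trans; apply.
  rewrite !muE// -!EFinM lee_fin /K mulrAC -!mulrA ler_wpM2l ?(ltW k20)//.
  rewrite mulrCA ler_wpM2l//; apply: C1P.
  - by rewrite h20/=; lra.
  - by rewrite mulrCA mulfV ?mulr1.
  - by rewrite distxx// mulr_ge0// ltW.
rewrite nneseriesZl// -measure_bigcup//; last first.
  move=> i j Ii Ij [w [/= xi xj]]; apply: contrapT => ij.
  have := usep _ _ Ii Ij ij; apply/negP; rewrite -leNgt.
  apply: le_trans (dist_tri dM w _ _) _; rewrite [leRHS]splitr.
  by rewrite lerD// distC.
apply: (@le_trans _ _ (K%:E * mu (cball dist x ((L + 1) * h)))%E).
  apply: lee_wpmul2l; first by rewrite lee_fin !mulr_ge0// ltW.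
  apply: le_measure; rewrite ?inE//; first exact: bigcup_measurable.
  move=> w [i Ii]; apply: subset_cball => //.
  have := (uS i Ii).1; rewrite /cball /= => xu; lra.
rewrite muE// -EFinM lee_fin.
have V : vol x ((L + 1) * h) <= C2 * vol y h by apply: C2P => //; lra.
have -> : k2 * C1 * C2 * vol y h * h `^ (- th) = K * (C2 * vol y h) by rewrite /K; ring.
by rewrite ler_wpM2l// !mulr_ge0// ltW.
Qed.

End AhlforsDavid.

(** * The dyadic weights of the measures [m_k] *)

Section Weights.
Context {R : realType}.

Lemma kr_bounds (r : R) : 0 < r ->
  2 `^ (kr r)%:~R <= r^-1 /\ r^-1 <= 2 * 2 `^ (kr r)%:~R.
Proof.
move=> r0; have ln20 : 0 < ln 2 :> R by rewrite ln_gt0// ltr1n.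
have rE : r^-1 = expR (- (ln r / ln 2) * ln 2).
  by rewrite mulNr divfK ?gt_eqF// expRN lnK.
have powE (x : R) : 2 `^ x = expR (x * ln 2) by rewrite /powR pnatr_eq0.
split.
  by rewrite rE powE ler_expR ler_pM2r// ge_floor.
rewrite -{1}(powRr1 (ler0n R 2)) -powRD; last by rewrite pnatr_eq0 implybT.
by rewrite rE powE ler_expR ler_pM2r// addrC -intrD1 ltW// floorD1_gt.
Qed.

(** The weight on [S1] is [2 ^ (k theta2)] times the weight on [S2]. With [k = kr r] this quotient
    is comparable with [r ^ (- theta2)], and so compensates that factor in the regularity of
    [S2]. *)
Lemma mk_weights (r theta theta2 : R) : 0 < r -> 0 <= theta2 ->
  r `^ theta2 * 2 `^ ((kr r)%:~R * theta) <= 2 `^ ((kr r)%:~R * (theta - theta2)) /\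
  2 `^ ((kr r)%:~R * (theta - theta2)) <= (2 * r) `^ theta2 * 2 `^ ((kr r)%:~R * theta).
Proof.
move=> r0 th0; pose t : R := 2 `^ (kr r)%:~R.
have [] := kr_bounds r0; rewrite -/t => t1 t2.
have t0 : 0 < t by rewrite powR_gt0.
have pow1 : 1 `^ theta2 = 1 :> R by rewrite powR1.
set w2 := 2 `^ (_ * (_ - _)).
have w20 : 0 <= w2 by exact: powR_ge0.
have -> : 2 `^ ((kr r)%:~R * theta) = t `^ theta2 * w2.
  rewrite /t /w2 -powRrM -powRD; last by rewrite pnatr_eq0 implybT.
  by congr (_ `^ _); ring.
rewrite !mulrA -!powRM ?mulr_ge0 ?(ltW r0) ?(ltW t0)//; split.
  rewrite -[leRHS]mul1r ler_wpM2r//.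
  rewrite -[leRHS]pow1 ge0_ler_powR ?nnegrE ?mulr_ge0 ?(ltW r0) ?(ltW t0)//.
  by rewrite mulrC -ler_pdivlMr// mul1r.
rewrite -[leLHS]mul1r ler_wpM2r// -[leLHS]pow1.
rewrite ge0_ler_powR ?nnegrE ?mulr_ge0 ?(ltW r0) ?(ltW t0)//.
by rewrite -mulrA mulrCA -ler_pdivrMl// mulr1.
Qed.

End Weights.

(** * Averages on small balls, bounded by averages against [m_k] on a large ball *)

Section LocalEstimates.
Context {d : measure_display} {T : measurableType d} {R : realType}.
Variable dist : T -> T -> R.
Hypotheses (dM : is_metric dist) (sepT : dseparable dist) (borelT : borel_structure dist).
Variable mu : {measure set T -> \bar R}.
Hypotheses (mu_lf : locally_finite dist mu) (mu_full : full_support dist mu)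
  (mu_dbl : unif_loc_doubling dist mu).
Variables (theta theta2 : R) (S1 S2 : set T) (H0 H2 : {measure set T -> \bar R}).
Hypotheses (H0E : forall A, measurable A -> H0 A = Hcal dist mu 0 A)
  (H2E : forall A, measurable A -> H2 A = Hcal dist mu theta2 A)
  (adrS1 : ADR dist mu 0 S1) (adrS2 : ADR dist mu theta2 S2) (th20 : 0 < theta2).
Variables (sigma c : R).
Hypotheses (sigma01 : 0 < sigma <= 1) (c_ge : 10 / sigma <= c).

Local Notation vol := (vol dist mu).
(** Here [h] is the scale of a gluing term and [rad h] the radius of the ball that enters [BSN]; the
    factor 2 in [bigball] is the one in [Etil]. *)
Local Notation rad h := (sigma / 2 * h).
Local Notation bigball x h := (cball dist x (2 * (c * rad h))).
Local Notation Av x h := (Avmk mu H2 S1 S2 theta theta2 (kr (rad h)) (bigball x h)).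
Local Notation w1 h := (2 `^ ((kr (rad h))%:~R * theta)).
Local Notation w2 h := (2 `^ ((kr (rad h))%:~R * (theta - theta2))).

Let sigma0 : 0 < sigma. Proof. by case/andP: sigma01. Qed.

Let mball x (r : R) : measurable (cball dist x r).
Proof. exact: cball_measurable. Qed.

Let mS1 : measurable S1. Proof. exact: (ADR_measurable borelT adrS1). Qed.
Let mS2 : measurable S2. Proof. exact: (ADR_measurable borelT adrS2). Qed.

Let bigradE (h : R) : 2 * (c * rad h) = c * sigma * h.
Proof. by field. Qed.

Let csigma : 10 <= c * sigma.
Proof. by rewrite -ler_pdivrMr. Qed.

(** The condition on [c] gives the big ball radius at least [10 h], which exceeds [5 h + h]. *)
Lemma sub_bigball x y (h : R) : 0 < h -> dist x y <= 5 * h ->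
  cball dist y h `<=` bigball x h.
Proof.
move=> h0 xy; apply: subset_cball => //; rewrite bigradE.
have : 10 * h <= c * sigma * h by rewrite ler_wpM2r// ltW.
lra.
Qed.

(** Doubling bounds the part on [S1] and regularity the part on [S2], whose factor [h ^ (- theta2)]
    is absorbed by the quotient of the weights. *)
Lemma mk_mass_le : exists K : R, 0 < K /\ forall x y (h : R),
  0 < h <= 1 -> dist x y <= 5 * h ->
  (mk_mass mu H2 S1 S2 theta theta2 (kr (rad h)) (bigball x h) <=
    (K * w1 h * vol y h)%:E)%E.
Proof.
have [C1 [C10 C1P]] := vol_comparable dM borelT mu_lf mu_full mu_dbl (c * sigma).
have [C2 [C20 C2P]] := ADR_upper dM sepT borelT mu_lf mu_full mu_dbl H2E adrS2 (c * sigma).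
exists (C1 + C2); split; first exact: addr_gt0.
move=> x y h h01 xy; have /andP[h0 h1] := h01.
have r0 : 0 < rad h by rewrite mulr_gt0// divr_gt0.
have xyL : dist x y <= c * sigma * h.
  by apply: le_trans xy _; rewrite ler_wpM2r ?(ltW h0)//; apply: le_trans csigma; rewrite ler_nat.
have w10 : 0 <= w1 h by exact: powR_ge0.
have vol0 : 0 <= vol y h by rewrite ltW// vol_gt0.
have -> : (C1 + C2) * w1 h * vol y h = C1 * w1 h * vol y h + C2 * w1 h * vol y h by ring.
rewrite EFinD /mk_mass bigradE; apply: leeD.
  have -> : C1 * w1 h * vol y h = w1 h * (C1 * vol y h) by ring.
  rewrite EFinM; apply: lee_wpmul2l; first by rewrite lee_fin.
  apply: (@le_trans _ _ (mu (cball dist x (c * sigma * h)))).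
    by apply: le_measure; rewrite ?inE//; exact: measurableI.
  by rewrite muE// lee_fin; apply: C1P.
apply: (@le_trans _ _ ((w2 h)%:E * (C2 * vol y h * h `^ (- theta2))%:E)%E).
  by apply: lee_wpmul2l; [rewrite lee_fin powR_ge0|exact: C2P].
rewrite -EFinM lee_fin.
have [_ w2w1] := mk_weights theta r0 (ltW th20).
have hth : h `^ theta2 * h `^ (- theta2) = 1.
  by rewrite powRN mulfV// gt_eqF// powR_gt0.
have {}w2w1 : w2 h * h `^ (- theta2) <= w1 h.
  apply: (@le_trans _ _ (h `^ theta2 * w1 h * h `^ (- theta2))).
    rewrite ler_wpM2r ?powR_ge0//; apply: le_trans w2w1 _; rewrite ler_wpM2r//.
    rewrite ge0_ler_powR ?nnegrE ?(ltW th20) ?(ltW h0)//; first by rewrite mulr_ge0// ltW.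
    have -> : 2 * rad h = sigma * h by field.
    by rewrite ler_piMl ?(ltW h0)//; case/andP: sigma01.
  by rewrite mulrAC hth mul1r.
have -> : w2 h * (C2 * vol y h * h `^ (- theta2)) = w2 h * h `^ (- theta2) * (C2 * vol y h).
  by ring.
have -> : C2 * w1 h * vol y h = w1 h * (C2 * vol y h) by ring.
by rewrite ler_wpM2r// mulr_ge0// ltW.
Qed.

(** The mass is bounded from above and one of the two nonnegative parts of the integral is dropped;
    for [S2] the quotient of the weights supplies [h ^ theta2]. *)
Lemma Avmk_ge : exists K : R, 0 < K /\ forall x y z (h : R) (g : T -> \bar R),
  0 < h <= 1 -> dist x y <= 5 * h -> S2 z -> dist x z <= 5 * h ->
  (forall u, (0 <= g u)%E) ->
  ((K * vol y h)^-1%:E * \int[mu]_(u in bigball x h `&` S1) g u <= Av x h g)%E /\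
  ((h `^ theta2 * (K * vol y h)^-1)%:E * \int[H2]_(u in bigball x h `&` S2) g u
    <= Av x h g)%E.
Proof.
have [K [K0 KP]] := mk_mass_le.
have [k [k0 kP]] := ADR_lower dM borelT mu_lf mu_dbl H2E adrS2.
have a0 : 0 < (sigma / 2) `^ theta2 by rewrite powR_gt0// divr_gt0.
(* The second entry pays for comparing the weights at radius [rad h] instead of [h], which loses
   [(sigma / 2) ^ theta2]. *)
exists (Num.max K (K / (sigma / 2) `^ theta2)).
split; first by rewrite lt_max K0.
move=> x y z h g h01 xy S2z xz g0; have /andP[h0 h1] := h01.
have r0 : 0 < rad h by rewrite mulr_gt0// divr_gt0.
have w10 : 0 < w1 h by exact: powR_gt0.
have w20 : 0 < w2 h by exact: powR_gt0.
have vy0 : 0 < vol y h by exact: vol_gt0.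
have Mle := KP x y h h01 xy.
set mass := mk_mass _ _ _ _ _ _ _ _ in Mle.
(* The point [z] of [S2] makes the mass positive, so [avg] does not take its default value 0. *)
have M0 : (0 < mass)%E.
  rewrite /mass /mk_mass; apply: (@lt_le_trans _ _ ((w2 h)%:E * H2 (bigball x h `&` S2))%E).
    apply: mule_gt0; first by rewrite lte_fin.
    apply: lt_le_trans (_ : (0 < (k * vol z h * h `^ (- theta2))%:E)%E) _.
      by rewrite lte_fin !mulr_gt0 ?powR_gt0// vol_gt0.
    apply: le_trans (kP z h S2z h01) _; apply: le_measure; rewrite ?inE;
      [exact: measurableI..|].
    by apply: setSI; exact: sub_bigball.
  by rewrite leeDr// mule_ge0// lee_fin ltW.
have [M ME] : exists M, mass = M%:E.
  exists (fine mass); rewrite fineK// ge0_fin_numE ?ltW//.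
  by apply: le_lt_trans Mle _; rewrite ltry.
have {}M0 : 0 < M by rewrite -lte_fin -ME.
have {}Mle : M <= K * w1 h * vol y h by rewrite -lee_fin -ME.
set I1 := (\int[mu]_(u in _) _)%E; set I2 := (\int[H2]_(u in _) _)%E.
have I10 : (0 <= I1)%E by exact: integral_ge0.
have I20 : (0 <= I2)%E by exact: integral_ge0.
have -> : Av x h g = ((w1 h / M)%:E * I1 + (w2 h / M)%:E * I2)%E.
  rewrite /Avmk -/mass ME avgE// /mk_int -/I1 -/I2.
  rewrite ge0_muleDr ?mule_ge0 ?lee_fin ?powR_ge0//.
  by rewrite !muleA -!EFinM ![M^-1 * _]mulrC.
have iw1 : 0 <= w1 h / M by rewrite divr_ge0 ?ltW.
have iw2 : 0 <= w2 h / M by rewrite divr_ge0 ?ltW.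
split.
  apply: (@le_trans _ _ ((w1 h / M)%:E * I1)%E); last first.
    by rewrite leeDl// mule_ge0// lee_fin.
  apply: lee_wpmul2r => //; rewrite lee_fin ler_pdivlMr//.
  rewrite mulrC ler_pdivrMr ?mulr_gt0 ?lt_max ?K0//.
  apply: le_trans Mle _.
  have -> : K * w1 h * vol y h = w1 h * (K * vol y h) by ring.
  rewrite ler_wpM2l ?(ltW w10)//.
  by rewrite ler_wpM2r ?(ltW vy0)// le_max lexx.
apply: (@le_trans _ _ ((w2 h / M)%:E * I2)%E); last first.
  by rewrite leeDr// mule_ge0// lee_fin.
apply: lee_wpmul2r => //; rewrite lee_fin ler_pdivlMr//.
have [w2w1 _] := mk_weights theta r0 (ltW th20).
rewrite mulrAC ler_pdivrMr ?mulr_gt0 ?lt_max ?K0//.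
apply: (@le_trans _ _ (h `^ theta2 * (K * w1 h * vol y h))).
  by rewrite ler_wpM2l// powR_ge0.
rewrite powRM ?(ltW h0) ?divr_ge0 ?(ltW sigma0)// in w2w1.
apply: (@le_trans _ _ (w2 h * (K / (sigma / 2) `^ theta2 * vol y h))); last first.
  rewrite ler_wpM2l ?(ltW w20)// ler_wpM2r ?(ltW vy0)//.
  by rewrite le_max lexx orbT.
apply: le_trans (_ : _ <= (sigma / 2) `^ theta2 * h `^ theta2 * w1 h
    * (K / (sigma / 2) `^ theta2 * vol y h)) _.
  rewrite le_eqVlt; apply/orP; left; apply/eqP; field.
  by rewrite gt_eqF.
rewrite ler_wpM2r// !mulr_ge0 ?invr_ge0// ltW//.
Qed.

(** The numerator passes from [H0] to [mu] by domination, and regularity of [S1] at [y] bounds the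
    denominator from below. *)
Lemma AvM_S1_le : exists K : R, 0 < K /\ forall x y z (h : R) (g : T -> \bar R),
  0 < h <= 1 -> S1 y -> dist x y <= 5 * h -> S2 z -> dist x z <= 5 * h ->
  (forall u, (0 <= g u)%E) -> measurable_fun setT g ->
  (AvM H0 (cball dist y h `&` S1) g <= K%:E * Av x h g)%E.
Proof.
have [K [K0 KP]] := Avmk_ge.
have [k [k0 kP]] := ADR_lower dM borelT mu_lf mu_dbl H0E adrS1.
have [C [C0 CP]] := integral_H0_le_mu dM sepT borelT mu_lf mu_full mu_dbl H0E.
exists (K * C / k); split; first by rewrite !mulr_gt0 ?invr_gt0.
move=> x y z h g h01 S1y xy S2z xz g0 mg; have /andP[h0 h1] := h01.
have vy0 : 0 < vol y h by exact: vol_gt0.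
have [+ _] := KP x y z h g h01 xy S2z xz g0.
set I := (\int[mu]_(u in _) _)%E => IAv.
have I0 : (0 <= I)%E by exact: integral_ge0.
have mB := measurableI _ _ (mball y h) mS1.
rewrite /AvM; set J := (\int[H0]_(_ in _) _)%E.
have JI : (J <= C%:E * I)%E.
  apply: le_trans (CP _ y h g mB _ g0 mg) _; first exact: subIsetl.
  apply: lee_wpmul2l; first by rewrite lee_fin ltW.
  apply: ge0_subset_integral => //; [exact: measurableI|exact: measurable_funTS|].
  by apply: setSI; exact: sub_bigball.
have J0 : (0 <= J)%E by exact: integral_ge0.
have := kP y h S1y h01; rewrite oppr0 powRr0 mulr1 => low.
have Av0 : (0 <= Av x h g)%E.
  by apply: le_trans IAv; rewrite mule_ge0// lee_fin invr_ge0 mulr_ge0// ltW.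
rewrite /avg; case: ifPn => [_|_]; last first.
  by rewrite mule_ge0// lee_fin !mulr_ge0 ?invr_ge0 ?ltW.
apply: (@le_trans _ _ ((k * vol y h)^-1%:E * J)%E).
  apply: lee_wpmul2r => //.
  (* An infinite mass has [fine] value 0, whose inverse is 0, so the bound holds in that case
     too. *)
  case: (H0 _) low => [m|_|] //=; rewrite ?lee_fin ?invr0.
    by move=> low; rewrite lef_pV2 ?posrE ?mulr_gt0//; apply: lt_le_trans low; rewrite mulr_gt0.
  by rewrite invr_ge0 mulr_ge0// ltW.
apply: (@le_trans _ _ ((k * vol y h)^-1%:E * (C%:E * I))%E).
  by apply: lee_wpmul2l => //; rewrite lee_fin invr_ge0 mulr_ge0// ltW.
apply: le_trans (lee_wpmul2l _ IAv); last by rewrite lee_fin !mulr_ge0 ?invr_ge0 ?ltW.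
rewrite !muleA -!EFinM; apply: lee_wpmul2r => //; rewrite lee_fin le_eqVlt.
by apply/orP; left; apply/eqP; field; rewrite !gt_eqF.
Qed.

(** As on [S1], except that the measure is already the one in [m_k]; [z] also serves as the centre
    for comparing volumes. *)
Lemma AvM_S2_le : exists K : R, 0 < K /\ forall x z (h : R) (g : T -> \bar R),
  0 < h <= 1 -> S2 z -> dist x z <= 5 * h ->
  (forall u, (0 <= g u)%E) -> measurable_fun setT g ->
  (AvM H2 (cball dist z h `&` S2) g <= K%:E * Av x h g)%E.
Proof.
have [K [K0 KP]] := Avmk_ge.
have [k [k0 kP]] := ADR_lower dM borelT mu_lf mu_dbl H2E adrS2.
exists (K / k); split; first by rewrite !mulr_gt0 ?invr_gt0.
move=> x z h g h01 S2z xz g0 mg; have /andP[h0 h1] := h01.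
have vz0 : 0 < vol z h by exact: vol_gt0.
have hth0 : 0 < h `^ theta2 by exact: powR_gt0.
have [_] := KP x z z h g h01 xz S2z xz g0.
set I := (\int[H2]_(u in _) _)%E => IAv.
have I0 : (0 <= I)%E by exact: integral_ge0.
have mB := measurableI _ _ (mball z h) mS2.
rewrite /AvM; set J := (\int[H2]_(_ in _) _)%E.
have JI : (J <= I)%E.
  apply: ge0_subset_integral => //; [exact: measurableI|exact: measurable_funTS|].
  by apply: setSI; exact: sub_bigball.
have J0 : (0 <= J)%E by exact: integral_ge0.
have := kP z h S2z h01; rewrite powRN => low.
have m0 : 0 < k * vol z h / h `^ theta2 by rewrite !mulr_gt0 ?invr_gt0.
have Av0 : (0 <= Av x h g)%E.
  by apply: le_trans IAv; rewrite mule_ge0// lee_fin mulr_ge0 ?invr_ge0 ?mulr_ge0// ltW.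
rewrite /avg; case: ifPn => [_|_]; last first.
  by rewrite mule_ge0// lee_fin !mulr_ge0 ?invr_ge0 ?ltW.
apply: (@le_trans _ _ ((k * vol z h / h `^ theta2)^-1%:E * J)%E).
  apply: lee_wpmul2r => //.
  case: (H2 _) low => [m|_|] //=; rewrite ?lee_fin ?invr0.
    by move=> low; rewrite lef_pV2 ?posrE//; apply: lt_le_trans low.
  by rewrite invr_ge0 ltW.
apply: (@le_trans _ _ ((k * vol z h / h `^ theta2)^-1%:E * I)%E).
  by apply: lee_wpmul2l => //; rewrite lee_fin invr_ge0 ltW.
apply: le_trans (lee_wpmul2l _ IAv); last by rewrite lee_fin !mulr_ge0 ?invr_ge0 ?ltW.
rewrite muleA -!EFinM; apply: lee_wpmul2r => //; rewrite lee_fin le_eqVlt.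
by apply/orP; left; apply/eqP; field; rewrite !gt_eqF.
Qed.

End LocalEstimates.

(** * One gluing term bounded by a sum over a net *)

Section GluingTerms.
Context {d : measure_display} {T : measurableType d} {R : realType}.
Variable dist : T -> T -> R.
Hypotheses (dM : is_metric dist) (sepT : dseparable dist) (borelT : borel_structure dist).
Variable mu : {measure set T -> \bar R}.
Hypotheses (mu_lf : locally_finite dist mu) (mu_full : full_support dist mu)
  (mu_dbl : unif_loc_doubling dist mu).

Local Notation vol := (vol dist mu).

Let mball x (r : R) : measurable (cball dist x r).
Proof. exact: cball_measurable. Qed.

Lemma scale01 (k : nat) : 0 < (2 ^- k : R) <= 1.
Proof. by rewrite invr_gt0 exprn_gt0//= invf_le1 ?exprn_gt0// exprn_ege1// ler1n. Qed.

Lemma powR_scale (k : nat) (x : R) : (2 ^- k) `^ x = 2 `^ (- (k%:R * x)).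
Proof.
rewrite -powR_mulrn// -powRN -powRrM; congr (_ `^ _); ring.
Qed.

Lemma nneseries_ge_term (u : nat -> \bar R) (i : nat) : (forall j, (0 <= u j)%E) ->
  (u i <= \sum_(j <oo) u j)%E.
Proof.
move=> u0; apply: le_trans (nneseries_lim_ge i.+1 _); last by [].
by rewrite big_nat_recr//= leeDr// sume_ge0.
Qed.

(** Both volumes in the weight are at least a constant times [vol x (2 ^- k)], so the power -1/2 of
    their product costs one inverse volume. *)
Lemma wk_le : exists C : R, 0 < C /\ forall (k : nat) x y z,
  dist x y <= 4 * 2 ^- k -> dist x z <= 4 * 2 ^- k ->
  (wk dist mu k y z <= (C / vol x (2 ^- k))%:E)%E.
Proof.
have [C [C0 CP]] := vol_comparable dM borelT mu_lf mu_full mu_dbl 4.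
exists C; split => // k x y z xy xz; have h01 := scale01 k; have /andP[h0 h1] := h01.
rewrite /wk !muE// -EFinM /= lee_fin.
have vpos w : 0 < vol w (2 ^- k) by exact: vol_gt0.
have h4 : (2 ^- k : R) <= 4 * 2 ^- k by rewrite ler_peMl ?(ltW h0)// ler1n.
have vy := CP _ _ _ _ h01 h4 xy.
have vz := CP _ _ _ _ h01 h4 xz.
set v := vol x _ in vy vz *; have v0 : 0 < v by exact: vpos.
have sq : (v / C) ^+ 2 <= vol y (2 ^- k) * vol z (2 ^- k).
  by rewrite expr2 ler_pM ?divr_ge0 ?(ltW v0) ?(ltW C0)// ler_pdivrMr// mulrC.
have vC0 : 0 < v / C by rewrite divr_gt0.
rewrite powRN -[C / v]invf_div lef_pV2 ?posrE ?powR_gt0 ?mulr_gt0 ?invr_gt0//.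
apply: (@le_trans _ _ (((v / C) ^+ 2) `^ 2^-1)); last first.
  apply: ge0_ler_powR; rewrite ?nnegrE ?invr_ge0 ?exprn_ge0 ?(ltW vC0)//.
  by rewrite mulr_ge0// ltW.
by rewrite -powR_mulrn ?(ltW vC0)// -powRrM mulfV// powRr1// ltW.
Qed.

(** The measures of the two balls give two volume factors, of which [wk] cancels one; the powers of
    [h] combine to [h ^ (- p)]. The net and the bounds [E] stay abstract so that both orders of the
    two sets are covered. *)
Lemma GLterm_le (p thi thj Ci Cj K : R) (Hi Hj : {measure set T -> \bar R}) (Si Sj : set T) :
  0 <= p -> 0 < Ci -> 0 < Cj -> 0 < K -> measurable Si -> measurable Sj ->
  (forall x y (h : R), 0 < h <= 1 -> dist x y <= 3 * h ->
    (Hi (cball dist x (3 * h) `&` Si) <= (Ci * vol y h * h `^ (- thi))%:E)%E) ->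
  (forall x y (h : R), 0 < h <= 1 -> dist x y <= 3 * h ->
    (Hj (cball dist x (3 * h) `&` Sj) <= (Cj * vol y h * h `^ (- thj))%:E)%E) ->
  exists C : R, 0 < C /\
  forall (f : T -> R) (k : nat) (I : set nat) (z : nat -> T) (E : nat -> \bar R),
  (forall i, (0 <= E i)%E) ->
  (forall y w, Si y -> Sj w -> dist y w <= 2 ^- k ->
    exists2 i, I i & dist (z i) w <= 3 * 2 ^- k) ->
  (forall i y w, I i -> Si y -> Sj w -> dist y w <= 2 ^- k -> dist (z i) w <= 3 * 2 ^- k ->
    (Aij dist Hi Hj Si Sj k f y w <= K%:E * E i)%E) ->
  (GLterm dist mu p thi thj Hi Hj Si Sj k f <= C%:E * \sum_(i <oo | i \in I)
    ((vol (z i) (2 ^- k) * (2 ^- k) `^ (- p))%:E * poweR (E i) p))%E.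
Proof.
move=> p0 Ci0 Cj0 K0 mSi mSj Hi_le Hj_le.
have [Cw [Cw0 wkP]] := wk_le.
exists (Cw * K `^ p * Ci * Cj); split; first by rewrite !mulr_gt0// powR_gt0.
move=> f k I z E E0 cov AE.
have h01 := scale01 k; have /andP[h0 h1] := h01.
set h : R := 2 ^- k in h01 h0 h1 cov AE *.
have vpos w : 0 < vol w h by exact: vol_gt0.
have Kp0 : 0 < K `^ p by exact: powR_gt0.
have hi0 : 0 < h `^ (- thi) by exact: powR_gt0.
have hj0 : 0 < h `^ (- thj) by exact: powR_gt0.
have Ep0 i : (0 <= poweR (E i) p)%E by exact: poweR_ge0.
have A0 y w : (0 <= Aij dist Hi Hj Si Sj k f y w)%E.
  by apply: AvM_ge0 => y'; apply: AvM_ge0 => z'; rewrite lee_fin.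
pose D w := [set y | Si y /\ dist y w <= h].
have DE w : D w = cball dist w h `&` Si.
  by apply/seteqP; split => y []; rewrite /cball /= (distC dM w).
pose J w := (\int[Hi]_(y in D w) (wk dist mu k y w * poweR (Aij dist Hi Hj Si Sj k f y w) p))%E.
have J0 w : (0 <= J w)%E.
  by apply: integral_ge0 => y _; rewrite mule_ge0 ?poweR_ge0// lee_fin powR_ge0.
set B := Cw * K `^ p * Ci * h `^ (- thi).
have B0 : 0 < B by rewrite !mulr_gt0.
have JE i w : I i -> Sj w -> dist (z i) w <= 3 * h -> (J w <= B%:E * poweR (E i) p)%E.
  move=> Ii Sw zw.
  have mD : measurable (D w) by rewrite DE; exact: measurableI.
  set b := Cw / vol (z i) h * K `^ p.
  have b0 : 0 <= b by rewrite !mulr_ge0 ?invr_ge0 ?ltW.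
  apply: (@le_trans _ _ (\int[Hi]_(y in D w) (cst (b%:E * poweR (E i) p) y))%E).
    apply: ge0_le_integral_nonmeas => y [Sy yw].
      by rewrite mule_ge0 ?poweR_ge0// lee_fin powR_ge0.
    rewrite /cst /b EFinM -muleA; apply: lee_pmul.
    - by rewrite lee_fin powR_ge0.
    - exact: poweR_ge0.
    - apply: wkP; last by apply: le_trans zw _; rewrite ler_wpM2r ?(ltW h0)// ler_nat.
      apply: le_trans (dist_tri dM w _ _) _; rewrite (distC dM w y) -/h; lra.
    - rewrite -poweR_EFin -poweRM ?lee_fin ?(ltW K0)//; apply: le_poweR => //.
      exact: AE.
  rewrite integral_cst//.
  apply: (@le_trans _ _ ((b%:E * poweR (E i) p) * (Ci * vol (z i) h * h `^ (- thi))%:E)%E).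
    apply: lee_wpmul2l; first by rewrite mule_ge0// lee_fin.
    apply: le_trans (Hi_le w (z i) h h01 _); last by rewrite (distC dM).
    rewrite DE; apply: le_measure; rewrite ?inE; [exact: measurableI..|].
    apply: setSI; apply: subset_cball => //; rewrite distxx// add0r; lra.
  rewrite muleAC -EFinM; apply: lee_wpmul2r => //; rewrite lee_fin le_eqVlt /b /B.
  by apply/orP; left; apply/eqP; field; rewrite gt_eqF.
(* The bound for [J w] depends on a net point near [w]. Summing the bounds over all net points, each
   cut off by the indicator of its ball, dominates [J] without a measurable selection. *)
pose g (i : nat) := if i \in I
  then (fun w => (B%:E * poweR (E i) p * (\1_(cball dist (z i) (3 * h)) w)%:E)%E) else cst 0%E.
have g0 i w : (0 <= g i w)%E.
  rewrite /g; case: ifP => // _; rewrite !mule_ge0// ?lee_fin ?(ltW B0)//.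
have mg i : measurable_fun Sj (g i).
  rewrite /g; case: ifP => _; last exact: measurable_cst.
  apply: emeasurable_funM; first exact: measurable_cst.
  by apply/measurable_EFinP; apply: measurable_funTS; exact: measurable_indic.
have Jg w : Sj w -> (J w <= \sum_(i <oo) g i w)%E.
  move=> Sw; have [[y [Sy yw]]|nD] := pselect (D w !=set0).
    have [i Ii zw] := cov y w Sy Sw yw.
    apply: le_trans (JE i w Ii Sw zw) _.
    apply: le_trans (nneseries_ge_term i (fun j => g0 j w)).
    have zw' : cball dist (z i) (3 * h) w by [].
    by rewrite /g (mem_set Ii) indicE (mem_set zw') mule1.
  have D0 : D w = set0 by apply/eqP; apply: contrapT => /negP/set0P.
  by rewrite /J D0 integral_set0; exact: nneseries_ge0.
rewrite /GLterm.
apply: (@le_trans _ _ ((2 `^ (k%:R * (p - thi - thj)))%:E *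
    \int[Hj]_(w in Sj) (\sum_(i <oo) g i w))%E).
  apply: lee_wpmul2l; first by rewrite lee_fin powR_ge0.
  by apply: ge0_le_integral_nonmeas => w Sw; [exact: J0|exact: Jg].
rewrite integral_nneseries// -!nneseriesZl//; last 2 first.
  by move=> i _; apply: mule_ge0 => //; rewrite lee_fin mulr_ge0 ?powR_ge0// ltW.
  by move=> i _; apply: integral_ge0.
rewrite [leRHS]eseries_mkcond; apply: lee_nneseries => [i _ _|i _].
  by apply: mule_ge0; [rewrite lee_fin powR_ge0|exact: integral_ge0].
rewrite /g; case: ifPn => [/set_mem Ii|_]; last by rewrite integral0_eq// mule0.
have BE0 : (0 <= B%:E * poweR (E i) p)%E by apply: mule_ge0 => //; rewrite lee_fin ltW.
have mind : measurable_fun Sj (fun w => (\1_(cball dist (z i) (3 * h)) w)%:E : \bar R).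
  by apply/measurable_EFinP; apply: measurable_funTS; exact: measurable_indic.
rewrite (ge0_integralZl Hj mSj mind)//.
rewrite integral_indic//.
apply: (@le_trans _ _ ((2 `^ (k%:R * (p - thi - thj)))%:E *
    ((B%:E * poweR (E i) p) * (Cj * vol (z i) h * h `^ (- thj))%:E))%E).
  apply: lee_wpmul2l; first by rewrite lee_fin powR_ge0.
  apply: lee_wpmul2l; first by apply: mule_ge0 => //; rewrite lee_fin ltW.
  by apply: Hj_le => //; rewrite distxx// mulr_ge0// ltW.
rewrite [X in (_ * X)%E]muleAC !muleA -!EFinM; apply: lee_wpmul2r => //.
rewrite lee_fin.
have hp : 2 `^ (k%:R * (p - thi - thj)) * h `^ (- thi) * h `^ (- thj) = h `^ (- p).
  rewrite /h !powR_scale -!powRD; [|by rewrite pnatr_eq0 implybT..].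
  by congr (_ `^ _); ring.
by rewrite -hp le_eqVlt; apply/orP; left; apply/eqP; rewrite /B; ring.
Qed.

End GluingTerms.

(** * Infima and double series of extended reals *)

Section ExtendedSums.
Context {R : realType}.

Lemma le_mule_ereal_inf (x : \bar R) (K : R) (F : R -> \bar R) : 0 < K ->
  (forall a, (x <= K%:E * F a)%E) -> (x <= K%:E * ereal_inf [set F a | a in [set: R]])%E.
Proof.
move=> K0 xF; rewrite -lee_pdivrMl//; apply: le_ereal_inf_tmp => _ [a _ <-].
by rewrite lee_pdivrMl.
Qed.

Lemma nneseries_le (u : nat -> \bar R) (B : \bar R) : (forall i, (0 <= u i)%E) ->
  (forall n, (\sum_(i < n) u i <= B)%E) -> (\sum_(i <oo) u i <= B)%E.
Proof.
move=> u0 uB; apply: lime_le; first exact: is_cvg_nneseries.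
by apply: nearW => n; rewrite big_mkord.
Qed.

(* If the members of each residue class of scales modulo [M.+1] sum to at most [B] over
   finite subfamilies, then the whole double series is at most [M.+1 * B]. *)
Lemma double_nneseries_le (u : nat -> nat -> \bar R) (M : nat) (B : \bar R) :
  (forall n i, (0 <= u n i)%E) ->
  (forall (s : seq (nat * nat)) (m : nat), uniq s ->
    (forall q, q \in s -> (q.1 %% M.+1 = m)%N) -> (\sum_(q <- s) u q.1 q.2 <= B)%E) ->
  (\sum_(n <oo) \sum_(i <oo) u n i <= M.+1%:R%:E * B)%E.
Proof.
move=> u0 uB.
apply: nneseries_le => [n|N]; first exact: nneseries_ge0.
(* The outer sum is finite now, so the sums are exchanged and the other index is truncated as
   well. *)
rewrite -nneseries_sum//; apply: nneseries_le => [i|L]; first exact: sume_ge0.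
rewrite exchange_big /= pair_bigA /=.
rewrite (partition_big (fun q : 'I_N * 'I_L => inord (q.1 %% M.+1)%N : 'I_M.+1) xpredT)//=.
apply: (@le_trans _ _ (\sum_(m < M.+1) B)%E).
  apply: lee_sum => m _.
  rewrite -big_filter -(big_map (fun q : 'I_N * 'I_L => (q.1 : nat, q.2 : nat)) xpredT
    (fun q => u q.1 q.2)).
  apply: (uB _ m).
    rewrite map_inj_uniq; first exact/filter_uniq/index_enum_uniq.
    by move=> [a b] [a' b'] /= [/val_inj -> /val_inj ->].
  move=> _ /mapP[q + ->] /=; rewrite mem_filter => /andP[/eqP <- _].
  by rewrite inordK// ltn_mod.
by rewrite mule_natl sumr_const card_ord.
Qed.

End ExtendedSums.

(** * Finite disjoint families as competitors for [BSN] *)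

Section BrudnyiShvartsman.
Context {d : measure_display} {T : measurableType d} {R : realType}.
Variables (dist : T -> T -> R) (mu H2 : {measure set T -> \bar R}) (S1 S2 : set T).
Variables (theta theta2 p c : R).
Hypothesis p0 : 0 < p.

(** The contribution of one ball to the [p]-th power of the functional. *)
Definition BSterm (f : T -> R) (x : T) (r : R) : \bar R :=
  (mu (cball dist x r) * ((r `^ p)^-1)%:E *
   poweR (Etil dist mu H2 S1 S2 theta theta2 (kr r) f x (c * r)) p)%E.

Local Notation BSN := (BSN dist mu H2 S1 S2 theta theta2 p c).

Lemma BSterm_ge0 f x r : (0 <= BSterm f x r)%E.
Proof. by rewrite !mule_ge0 ?poweR_ge0// lee_fin invr_ge0 powR_ge0. Qed.

(** Enumerating the list turns it into a nice family. The general index type admits pairs of a scale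
    and a net index. *)
Lemma sum_BSterm_le (J : eqType) (s : seq J) (x : J -> T) (r : J -> R) (f : T -> R) :
  uniq s ->
  (forall a b, a \in s -> b \in s -> a != b ->
    cball dist (x a) (r a) `&` cball dist (x b) (r b) = set0) ->
  (forall a, a \in s -> 0 < r a <= 1) ->
  (forall a, a \in s -> cball dist (x a) (c * r a) `&` SS S1 S2 !=set0) ->
  (\sum_(a <- s) BSterm f (x a) (r a) <= poweR (BSN f) p)%E.
Proof.
case: s => [|a0 s]; first by rewrite big_nil poweR_ge0.
set t := a0 :: s => ut disj rad01 meet.
have sum0 : (0 <= \sum_(a <- t) BSterm f (x a) (r a))%E.
  by apply: sume_ge0 => a _; exact: BSterm_ge0.
rewrite -[leLHS]poweRe1// -(mulVf (lt0r_neq0 p0)) poweRrM.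
apply: le_poweR; [exact: ltW|exact: poweR_ge0|].
apply: ereal_sup_ubound; exists (size t), (x \o nth a0 t), (r \o nth a0 t).
split; last by rewrite (big_nth a0) big_mkord.
split; [|split].
- move=> i j it jt ij; apply: disj; rewrite ?mem_nth//.
  by rewrite nth_uniq//; apply/eqP.
- by move=> i it; apply: rad01; rewrite mem_nth.
- by move=> i it; apply: meet; rewrite mem_nth.
Qed.

(** The empty family is a competitor with value 0. *)
Lemma BSN_ge0 f : (0 <= BSN f)%E.
Proof.
apply: ereal_sup_ubound; exists 0%N, (fun=> point), (fun=> 1); split; first by split; [|split].
by rewrite big_ord0 poweR0r// invr_neq0// gt_eqF.
Qed.

End BrudnyiShvartsman.

(** * Porous balls at all scales and the summed estimate *)

Section GluingBound.
Context {d : measure_display} {T : measurableType d} {R : realType}.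
Variable dist : T -> T -> R.
Hypotheses (dM : is_metric dist) (sepT : dseparable dist) (borelT : borel_structure dist).
Variable mu : {measure set T -> \bar R}.
Hypotheses (mu_lf : locally_finite dist mu) (mu_full : full_support dist mu)
  (mu_dbl : unif_loc_doubling dist mu).
Variables (p theta theta2 : R) (S1 S2 : set T) (H0 H2 : {measure set T -> \bar R}).
Hypotheses (H0E : forall A, measurable A -> H0 A = Hcal dist mu 0 A)
  (H2E : forall A, measurable A -> H2 A = Hcal dist mu theta2 A)
  (adrS1 : ADR dist mu 0 S1) (adrS2 : ADR dist mu theta2 S2)
  (p0 : 0 < p) (th20 : 0 < theta2).
Variables (sigma c : R).
Hypotheses (sigma01 : 0 < sigma <= 1) (c_ge : 10 / sigma <= c)
  (porS2 : porous dist sigma S2).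

Local Notation vol := (vol dist mu).
Local Notation rad h := (sigma / 2 * h).
Local Notation Em f x h := (Emk mu H2 S1 S2 theta theta2 (kr (rad h)) f
  (cball dist x (2 * (c * rad h)))).
Local Notation BSN := (BSN dist mu H2 S1 S2 theta theta2 p c).
Local Notation BSterm := (BSterm dist mu H2 S1 S2 theta theta2 p c).

Let sigma0 : 0 < sigma. Proof. by case/andP: sigma01. Qed.
Let mS1 : measurable S1. Proof. exact: (ADR_measurable borelT adrS1). Qed.
Let mS2 : measurable S2. Proof. exact: (ADR_measurable borelT adrS2). Qed.
Let mball x (r : R) : measurable (cball dist x r).
Proof. exact: cball_measurable. Qed.

(** Regularity keeps the masses away from 0 and infinity, as the estimate of double averages
    requires. *)
Lemma ADR_mass (th : R) (S : set T) (H : {measure set T -> \bar R}) x (h : R) :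
  (forall A, measurable A -> H A = Hcal dist mu th A) -> ADR dist mu th S ->
  S x -> 0 < h <= 1 -> exists2 m : R, 0 < m & H (cball dist x h `&` S) = m%:E.
Proof.
move=> HE adrS Sx h01; have /andP[h0 h1] := h01.
have [k [k0 kP]] := ADR_lower dM borelT mu_lf mu_dbl HE adrS.
have [C [C0 CP]] := ADR_upper dM sepT borelT mu_lf mu_full mu_dbl HE adrS 1.
have low := kP x h Sx h01.
have := CP x x h h01; rewrite distxx// !mul1r => /(_ (ltW h0)) up.
have fin : H (cball dist x h `&` S) \is a fin_num.
  by rewrite ge0_fin_numE//; apply: le_lt_trans up _; rewrite ltry.
exists (fine (H (cball dist x h `&` S))); last by rewrite fineK.
rewrite -lte_fin fineK//; apply: lt_le_trans low.
by rewrite lte_fin !mulr_gt0 ?powR_gt0// vol_gt0.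
Qed.

(** For each constant [a] the double average splits into averages of [|f - a|] on the two sets. Both
    are bounded by one average of [|f - a|] on the big ball, so the infimum over [a] can be taken
    afterwards. *)
Lemma Aij_le : exists K : R, 0 < K /\ forall (f : T -> R) (k : nat) x y z,
  measurable_fun setT f -> S1 y -> S2 z ->
  dist x y <= 5 * 2 ^- k -> dist x z <= 5 * 2 ^- k ->
  (Aij dist H0 H2 S1 S2 k f y z <= K%:E * Em f x (2 ^- k))%E /\
  (Aij dist H2 H0 S2 S1 k f z y <= K%:E * Em f x (2 ^- k))%E.
Proof.
have [K1 [K10 K1P]] := AvM_S1_le dM sepT borelT mu_lf mu_full mu_dbl theta H0E H2E adrS1 adrS2 th20
  sigma01 c_ge.
have [K2 [K20 K2P]] := AvM_S2_le dM sepT borelT mu_lf mu_full mu_dbl theta H2E adrS1 adrS2 th20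
  sigma01 c_ge.
exists (K1 + K2); split; first exact: addr_gt0.
move=> f k x y z mf S1y S2z xy xz; have h01 := scale01 (R := R) k.
have [m1 m10 m1E] := ADR_mass H0E adrS1 S1y h01.
have [m2 m20 m2E] := ADR_mass H2E adrS2 S2z h01.
have mB1 := measurableI _ _ (mball y (2 ^- k)) mS1.
have mB2 := measurableI _ _ (mball z (2 ^- k)) mS2.
have mfa (a : R) : measurable_fun setT (fun u => (`|f u - a|)%:E).
  by apply/measurable_EFinP; apply: measurableT_comp => //; exact: measurable_funB.
have fa0 (a : R) u : (0 <= (`|f u - a|)%:E)%E by rewrite lee_fin.
have A1 (a : R) := K1P x y z (2 ^- k) _ h01 S1y xy S2z xz (fa0 a) (mfa a).
have A2 (a : R) := K2P x z (2 ^- k) _ h01 S2z xz (fa0 a) (mfa a).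
have KD X : ((K1 + K2)%:E * X = K1%:E * X + K2%:E * X)%E.
  by rewrite EFinD ge0_muleDl// lee_fin ltW.
split; apply: le_mule_ereal_inf => [|a]; try exact: addr_gt0; rewrite KD.
  apply: le_trans (AvM_AvM_le a mB1 mB2 m1E m2E m10 m20 mf) _.
  exact: leeD (A1 a) (A2 a).
apply: le_trans (AvM_AvM_le a mB2 mB1 m2E m1E m20 m10 mf) _.
rewrite [leRHS]addeC; exact: leeD (A2 a) (A1 a).
Qed.

(* Porosity moves the centre of the ball off [S2] by an amount comparable with the scale. *)
Lemma porous_centers : exists (I : nat -> set nat) (z b : nat -> nat -> T), forall n,
  let h : R := 2 ^- n.+1 in
  [/\ forall i, I n i -> [/\ S2 (z n i), dist (z n i) (b n i) <= h &
        cball dist (b n i) (sigma * h) `<=` cball dist (z n i) h `\` S2],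
      forall i j, I n i -> I n j -> i <> j -> 2 * h < dist (z n i) (z n j) &
      forall w, S2 w -> exists2 i, I n i & dist (z n i) w <= 2 * h].
Proof.
have net n : exists t : set nat * (nat -> T), let h : R := 2 ^- n.+1 in
    [/\ forall i, t.1 i -> S2 (t.2 i),
      forall i j, t.1 i -> t.1 j -> i <> j -> 2 * h < dist (t.2 i) (t.2 j) &
      forall w, S2 w -> exists2 i, t.1 i & dist (t.2 i) w <= 2 * h].
  have /andP[h0 _] := scale01 (R := R) n.+1.
  have [|I [x IxP]] := separated_net dM S2 (s := 2 * 2 ^- n.+1) sepT; first by rewrite mulr_gt0.
  by exists (I, x).
have [t tP] := choice net.
have center q : exists y : T, (t q.1).1 q.2 ->
    let h : R := 2 ^- q.1.+1 in let z := (t q.1).2 q.2 in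
    dist z y <= h /\ cball dist y (sigma * h) `<=` cball dist z h `\` S2.
  have [Iq|nIq] := pselect ((t q.1).1 q.2); last by exists point.
  have [S2t _ _] := tP q.1; have h01 := scale01 (R := R) q.1.+1; have /andP[h0 _] := h01.
  (* The porous ball has radius at least [sigma * h]; it contains its centre, which therefore lies
     within [h] of the net point. *)
  have [y [r' [rr' sub]]] := porS2 (S2t _ Iq) h01.
  exists y => _ /=; have yr : cball dist y r' y.
    by apply: (cballxx dM); apply: le_trans rr'; rewrite mulr_ge0// ltW.
  split; first by case: (sub _ yr).
  by move=> w /= yw; apply: sub; rewrite /cball /=; exact: le_trans rr'.
have [b bP] := choice center.
exists (fun n => (t n).1), (fun n => (t n).2), (fun n i => b (n, i)) => n h.
have [S2t sept covt] := tP n; split => // i Ii.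
by have [] := bP (n, i) Ii; split => //; exact: S2t.
Qed.

Lemma GL3_le_BSN : exists C : R, 0 < C /\ forall f : T -> R, measurable_fun setT f ->
  (GL3 dist mu p theta2 H0 H2 S1 S2 f <= C%:E * BSN f)%E.
Proof.
have [K [K0 KP]] := Aij_le.
have [U1 [U10 U1P]] := ADR_upper dM sepT borelT mu_lf mu_full mu_dbl H0E adrS1 3.
have [U2 [U20 U2P]] := ADR_upper dM sepT borelT mu_lf mu_full mu_dbl H2E adrS2 3.
have [C1 [C10 C1P]] := GLterm_le dM borelT mu_lf mu_full mu_dbl (ltW p0) U10 U20 K0 mS1 mS2
  U1P U2P.
have [C2 [C20 C2P]] := GLterm_le dM borelT mu_lf mu_full mu_dbl (ltW p0) U20 U10 K0 mS2 mS1
  U2P U1P.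
have [C3 [C30 C3P]] := vol_comparable dM borelT mu_lf mu_full mu_dbl (2 / sigma).
have [I [z [b zbP]]] := porous_centers.
(* As [2 / sigma < 2 ^ M], after [M] halvings a scale is at most [rad] of the original one. In [h]
   the exponent is shifted because the gluing sum starts at [k = 1]. *)
pose M := Num.Def.archi_bound (2 / sigma).
pose h n : R := 2 ^- n.+1.
have h01 n : 0 < h n <= 1 by exact: scale01.
have h0 n : 0 < h n by case/andP: (h01 n).
have r0 n : 0 < rad (h n) by rewrite mulr_gt0// divr_gt0.
have /andP[sg0 s1] := sigma01.
have rh n : rad (h n) <= h n by rewrite ler_piMl ?(ltW (h0 n))//; lra.
have r01 n : 0 < rad (h n) <= 1.
  by rewrite r0/=; apply: le_trans (rh n) _; case/andP: (h01 n).
have S2z n i : I n i -> S2 (z n i) by case: (zbP n) => + _ _ => /[apply] -[].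
have zb n i : I n i -> dist (z n i) (b n i) <= h n.
  by case: (zbP n) => + _ _ => /[apply] -[].
have bsub n i : I n i -> cball dist (b n i) (sigma * h n) `<=` cball dist (z n i) (h n) `\` S2.
  by case: (zbP n) => + _ _ => /[apply] -[].
have bsub' n i : I n i -> cball dist (b n i) (rad (h n)) `<=` cball dist (z n i) (h n) `\` S2.
  move=> Ii; apply: subset_trans (bsub n i Ii); apply: subset_cball => //.
  rewrite distxx// add0r ler_wpM2r ?(ltW (h0 n))//; lra.
(* If the balls met, the finer net point [z m j], which lies in [S2], would be within
   [rad (h n) + h m <= sigma * h n] of [b n i], inside a ball that misses [S2]. *)
have disj_lt n m i j : (n + M.+1 <= m)%N -> I n i -> I m j ->
    cball dist (b n i) (rad (h n)) `&` cball dist (b m j) (rad (h m)) = set0.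
  move=> nm Ii Ij; rewrite -subset0 => w [/= bw /(bsub' _ _ Ij)[/= zw _]].
  have nm' : (n <= m)%N by apply: leq_trans nm; exact: leq_addr.
  have hm : h m <= rad (h n).
    have -> : h m = h n * 2 ^- (m - n).
      by rewrite /h -invfM -exprD addSn subnKC.
    rewrite mulrC ler_wpM2r ?(ltW (h0 n))// -[sigma / 2]invf_div.
    rewrite lef_pV2 ?posrE ?exprn_gt0 ?divr_gt0// ltW// upper_nthrootP//.
    rewrite leq_subRL//; apply: leq_trans nm; rewrite leq_add2l; exact: leqnSn.
  have [|_] := bsub _ _ Ii (z m j); last by apply; exact: S2z.
  rewrite /cball /=; apply: le_trans (dist_tri dM w _ _) _.
  rewrite (distC dM w).
  have -> : sigma * h n = rad (h n) + rad (h n) by field.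
  by apply: lerD => //; exact: le_trans hm.
(* In one residue class two scales are equal or at least [M + 1] steps apart. At equal scales the
   balls lie in balls of radius [h n] about net points more than [2 * h n] apart. *)
have disj n m i j : (n = m %[mod M.+1])%N -> I n i -> I m j -> (n, i) <> (m, j) ->
    cball dist (b n i) (rad (h n)) `&` cball dist (b m j) (rad (h m)) = set0.
  have far a a' : (a < a')%N -> (a = a' %[mod M.+1])%N -> (a + M.+1 <= a')%N.
    move=> aa' /eqP; rewrite eq_sym eqn_mod_dvd ?(ltnW aa')// => dv.
    by rewrite -leq_subRL ?(ltnW aa')// dvdn_leq// subn_gt0.
  move=> nm Ii Ij ij; case: (ltngtP n m) => [lt|lt|eq].
  - by apply: disj_lt => //; exact: far.
  - by rewrite setIC; apply: disj_lt => //; apply: far.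
  subst m; rewrite -subset0 => w [/(bsub' _ _ Ii)[/= zi _] /(bsub' _ _ Ij)[/= zj _]].
  have [_ + _] := zbP n => /(_ i j Ii Ij); rewrite -/(h n) => sep.
  have : 2 * h n < dist (z n i) (z n j) by apply: sep => eij; apply: ij; rewrite eij.
  apply/negP; rewrite -leNgt; apply: le_trans (dist_tri dM w _ _) _.
  rewrite (distC dM w); have -> : 2 * h n = h n + h n by ring.
  exact: lerD.
have cr n : h n <= c * rad (h n).
  rewrite mulrA -[leLHS]mul1r ler_wpM2r ?(ltW (h0 n))//.
  have : 10 <= c * sigma by rewrite -ler_pdivrMr.
  rewrite mulrA; lra.
(* The dilated ball contains the net point, so [Etil] is the oscillation and not its default value
   0. *)
have meet n i : I n i -> cball dist (b n i) (c * rad (h n)) `&` SS S1 S2 !=set0.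
  move=> Ii; exists (z n i); split; last by right; exact: S2z.
  by rewrite /cball /= (distC dM); apply: le_trans (zb _ _ Ii) (cr n).
(* [C1 + C2] stands for the two orders of the gluing sum, [C3] for the change from net points to
   porous balls, [M.+1] for the residue classes. *)
set C : R := (C1 + C2) * C3 * M.+1%:R.
have C_gt0 : 0 < C by rewrite !mulr_gt0// addr_gt0.
exists (C `^ p^-1); split; first exact: powR_gt0.
move=> f mf.
pose u n i := if i \in I n then BSterm f (b n i) (rad (h n)) else 0%E.
have u0 n i : (0 <= u n i)%E by rewrite /u; case: ifP => // _; exact: BSterm_ge0.
have sum_u : (\sum_(n <oo) \sum_(i <oo) u n i <= M.+1%:R%:E * poweR (BSN f) p)%E.
  apply: double_nneseries_le => // s m us sm.
  rewrite /u -big_mkcond -big_filter.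
  apply: (@sum_BSterm_le _ _ _ dist mu H2 S1 S2 theta theta2 p c p0 _ _
    (fun q => b q.1 q.2) (fun q => rad (h q.1))) => //.
  - exact: filter_uniq.
  - move=> [n i] [n' i']; rewrite !mem_filter => /andP[/set_mem /= Ii qs].
    move=> /andP[/set_mem /= Ii' qs'].
    by move=> /eqP ne; apply: disj => //; rewrite (sm _ qs) (sm _ qs').
  - by move=> q; rewrite mem_filter => /andP[/set_mem /= Iq _]; exact: meet.
pose E n i := Em f (b n i) (h n).
have E0 n i : (0 <= E n i)%E.
  apply: le_ereal_inf_tmp => _ [a _ <-]; apply: avg_ge0.
    by rewrite /mk_mass adde_ge0// mule_ge0// lee_fin powR_ge0.
  by rewrite /mk_int adde_ge0// mule_ge0 ?lee_fin ?powR_ge0//; exact: integral_ge0.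
have termE n i : I n i -> BSterm f (b n i) (rad (h n)) =
    ((vol (b n i) (rad (h n)) * (rad (h n)) `^ (- p))%:E * poweR (E n i) p)%E.
  move=> Ii; rewrite /BSterm /Etil asboolT; last exact: meet.
  by rewrite muE// -EFinM powRN.
(* Replacing [z n i] and [h n] by [b n i] and [rad (h n)] costs a constant in the volume, while the
   power [- p] of the radius only grows. *)
have term_le n : (\sum_(i <oo | i \in I n)
    ((vol (z n i) (h n) * (h n) `^ (- p))%:E * poweR (E n i) p) <=
    C3%:E * \sum_(i <oo) u n i)%E.
  rewrite -nneseriesZl// eseries_mkcond; apply: lee_nneseries => [i _ _|i _].
    by case: ifP => // _; rewrite mule_ge0 ?poweR_ge0// lee_fin mulr_ge0 ?powR_ge0// ltW// vol_gt0.
  rewrite /u; case: ifPn => [/set_mem Ii|_]; last by rewrite mule0.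
  rewrite termE// muleA -EFinM; apply: lee_wpmul2r; first exact: poweR_ge0.
  have hr : h n = 2 / sigma * rad (h n) by field; rewrite gt_eqF.
  rewrite lee_fin mulrA; apply: ler_pM; rewrite ?powR_ge0 ?(ltW (vol_gt0 _ _ _ _ _ _))//.
  - by rewrite ltW// vol_gt0.
  - by apply: C3P => //; rewrite -hr// zb.
  - rewrite !powRN lef_pV2 ?posrE ?powR_gt0// ge0_ler_powR ?nnegrE// ltW//.
have near1 n i y w : I n i -> S1 y -> S2 w -> dist y w <= h n ->
    dist (b n i) w <= 4 * h n -> dist (b n i) y <= 5 * h n.
  move=> Ii Sy Sw yw bw; apply: le_trans (dist_tri dM w _ _) _; rewrite (distC dM w); lra.
have bz n i w : I n i -> dist (z n i) w <= 3 * h n -> dist (b n i) w <= 4 * h n.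
  move=> Ii zw; apply: le_trans (dist_tri dM (z n i) _ _) _.
  by have := zb _ _ Ii; rewrite (distC dM (b n i)); lra.
have four n t : t <= 4 * h n -> t <= 5 * h n.
  by move=> t4; apply: le_trans t4 _; rewrite ler_wpM2r ?(ltW (h0 n))// ler_nat.
have GL1 n : (GLterm dist mu p 0 theta2 H0 H2 S1 S2 n.+1 f <= (C1 * C3)%:E * \sum_(i <oo) u n i)%E.
  apply: le_trans (C1P f n.+1 (I n) (z n) (E n) (E0 n) _ _) _.
  - move=> y w S1y S2w yw; have [_ _ /(_ w S2w)[i Ii zw]] := zbP n.
    by exists i => //; apply: le_trans zw _; rewrite ler_wpM2r ?(ltW (h0 n))// ler_nat.
  - move=> i y w Ii S1y S2w yw zw; have bw := bz _ _ _ Ii zw.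
    by have [] := KP f n.+1 (b n i) y w mf S1y S2w (near1 _ _ _ _ Ii S1y S2w yw bw) (four _ _ bw).
  by rewrite EFinM -muleA; apply: lee_wpmul2l; [rewrite lee_fin ltW|exact: term_le].
have GL2 n : (GLterm dist mu p theta2 0 H2 H0 S2 S1 n.+1 f <= (C2 * C3)%:E * \sum_(i <oo) u n i)%E.
  apply: le_trans (C2P f n.+1 (I n) (z n) (E n) (E0 n) _ _) _.
  (* Here [w] lies in [S1] while the net covers [S2] and is near [y]; hence the radius
     [3 h = 2 h + h] in the covering condition. *)
  - move=> y w S2y S1w yw; have [_ _ /(_ y S2y)[i Ii zy]] := zbP n.
    exists i => //; apply: le_trans (dist_tri dM y _ _) _.
    by move: zy yw; rewrite -/(h n); lra.
  - move=> i y w Ii S2y S1w yw zw; have bw := bz _ _ _ Ii zw.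
    have bY : dist (b n i) y <= 5 * h n.
      apply: le_trans (dist_tri dM w _ _) _; rewrite (distC dM w).
      by move: yw bw; rewrite -/(h n); lra.
    by have [] := KP f n.+1 (b n i) w y mf S1w S2y (four _ _ bw) bY.
  by rewrite EFinM -muleA; apply: lee_wpmul2l; [rewrite lee_fin ltW|exact: term_le].
have su0 n : (0 <= \sum_(i <oo) u n i)%E by exact: nneseries_ge0.
have GL0 thi thj Hi Hj Si Sj n : (0 <= GLterm dist mu p thi thj Hi Hj Si Sj n f)%E.
  rewrite mule_ge0 ?lee_fin ?powR_ge0//; apply: integral_ge0 => w _; apply: integral_ge0 => y _.
  by rewrite mule_ge0 ?poweR_ge0// lee_fin powR_ge0.
have -> : ((C `^ p^-1)%:E * BSN f = poweR (C%:E * poweR (BSN f) p) p^-1)%E.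
  rewrite poweRM ?poweR_ge0 ?lee_fin ?(ltW C_gt0)// -poweRrM mulfV ?lt0r_neq0//.
  by rewrite poweRe1 ?BSN_ge0.
apply: le_poweR; first by rewrite invr_ge0 ltW.
  by apply: nneseries_ge0 => n _ _; rewrite adde_ge0.
apply: (@le_trans _ _ (\sum_(n <oo) (((C1 + C2) * C3)%:E * \sum_(i <oo) u n i))%E).
  apply: lee_nneseries => [n _ _|n _]; first by rewrite adde_ge0.
  rewrite mulrDl EFinD ge0_muleDl ?lee_fin ?mulr_ge0 ?(ltW C10) ?(ltW C20) ?(ltW C30)//.
  exact: leeD.
rewrite nneseriesZl//.
have -> : C%:E = (((C1 + C2) * C3)%:E * M.+1%:R%:E)%E by rewrite -EFinM.
rewrite -muleA; apply: lee_wpmul2l => //.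
by rewrite lee_fin ltW// mulr_gt0// addr_gt0.
Qed.

End GluingBound.

Theorem theorem3p20 (R : realType) (sigma2 : R) :
  0 < sigma2 <= 1 ->
  exists cl : R, 1 <= cl /\
  forall (d : measure_display) (T : measurableType d) (dist : T -> T -> R)
    (mu : {measure set T -> \bar R}) (p theta2 theta : R)
    (S1 S2 : set T) (H0 H2 : {measure set T -> \bar R}),
    (* standing assumptions on (X, d, mu) and p *)
    is_metric dist -> dcomplete dist -> dseparable dist ->
    borel_structure dist ->
    locally_finite dist mu -> full_support dist mu ->
    unif_loc_doubling dist mu ->
    1 < p -> weak_local_poincare dist mu p ->
    (* H0 and H2 are the restrictions of H_0 and H_{theta2} to Borel sets *)
    (forall A, measurable A -> H0 A = Hcal dist mu 0 A) ->
    (forall A, measurable A -> H2 A = Hcal dist mu theta2 A) ->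
    (* hypotheses of the theorem *)
    0 < theta2 -> theta2 < p -> (theta2%:E < Qlow dist mu)%E ->
    theta2 <= theta -> theta < p ->
    ADR dist mu 0 S1 -> ADR dist mu theta2 S2 ->
    porous dist sigma2 S2 ->
    forall c : R, cl <= c ->
    exists C : R, 0 < C /\
      forall f : T -> R, Lp_m0 mu H2 S1 S2 theta theta2 p f ->
        (GL3 dist mu p theta2 H0 H2 S1 S2 f
         <= C%:E * BSN dist mu H2 S1 S2 theta theta2 p c f)%E.
Proof.
move=> sigma01; have /andP[sigma0 sigma1] := sigma01.
(* This bound depends on the porosity constant alone; it makes the doubled dilate of a ball of
   radius [sigma2 * h / 2] have radius at least [10 h]. *)
exists (10 / sigma2); split.
  by rewrite ler_pdivlMr// mul1r; apply: le_trans sigma1 _; rewrite ler1n.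
move=> d T dist mu p theta2 theta S1 S2 H0 H2 dM _ sepT borelT mu_lf mu_full mu_dbl p1 _.
move=> H0E H2E th20 _ _ _ _ adrS1 adrS2 porS2 c c_ge.
have p0 : 0 < p by exact: lt_trans p1.
have [C [C0 CP]] := GL3_le_BSN dM sepT borelT mu_lf mu_full mu_dbl theta H0E H2E adrS1 adrS2 p0 th20
  sigma01 c_ge porS2.
by exists C; split => // f [mf _]; exact: CP.
Qed.
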